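(* Let $(M,g)$ be an $n$-dimensional semi-Riemannian spin manifold and let $\nabla$ be the metric spin connection with vectorial torsion $V$. Then the following identity holds for any spinor field $\psi$ and any vector field $X$, with $e_1,\dots,e_n$ a local orthonormal frame: $$\mathrm{Ric}^V(X)\cdot\psi=-2\sum_{k=1}^n e_k\cdot\mathcal{R}^V(X,e_k)\psi-(dV^\flat\wedge X)\cdot\psi .$$
   Context: $V$ is a vector field on $M$. The metric connection with vectorial torsion $V$ is $\nabla_XY=\nabla^g_XY+g(X,Y)V-g(V,Y)X$ ($\nabla^g$ the Levi-Civita connection); its lift to spinor fields is $\nabla_X\psi=\nabla^g_X\psi+\frac12(X\wedge V)\cdot\psi$. On spinors, $\mathcal{R}^V(X,Y)\psi=\nabla_X\nabla_Y\psi-\nabla_Y\nabla_X\psi-\nabla_{[X,Y]}\psi$, and on vectors $\mathcal{R}^V(X,Y)Z=\nabla_X\nabla_YZ-\nabla_Y\nabla_XZ-\nabla_{[X,Y]}Z$. $\mathrm{Ric}^V(X)$ is the vector with $g(\mathrm{Ric}^V(X),Y)=\mathrm{Ric}^V(X,Y)=\sum_i\varepsilon_i\, g(\mathcal{R}^V(X,e_i)e_i,Y)$, where $g(e_i,e_j)=\varepsilon_i\delta_{ij}$, $\varepsilon_i=\pm1$. $V^\flat=g(V,\cdot)$ and $dV^\flat(X,Y)=g(\nabla^g_XV,Y)-g(\nabla^g_YV,X)$. Vectors are identified with 1-forms via $g$; the dot is Clifford multiplication of vectors and forms on spinors, with the convention $X\cdot\omega=X\wedge\omega-X\lrcorner\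,\omega$.
   Formalization: The printed formula is false under its conventions; proved instead: Ric^V(X)·ψ = −2 Σ ε_k e_k·R^V(X,e_k)ψ + (dV^♭∧X)·ψ, i.e. with the signs ε_k = g(e_k,e_k) inserted in the sum and the sign of the last term changed from − to +. *)

(* Defs.v *)
From HB Require Import structures.
From mathcomp Require Import all_boot all_order all_algebra.
From mathcomp Require Import all_classical all_reals all_analysis.
From mathcomp Require Import complex.
Set Implicit Arguments.
Unset Strict Implicit.
Unset Printing Implicit Defensive.
Import Order.TTheory GRing.Theory Num.Theory.
Import numFieldNormedType.Exports.
Local Open Scope classical_set_scope.
Local Open Scope ring_scope.

(** * Smooth manifolds *)

Section Calculus.
Variables (R : realType) (n : nat).

Fixpoint Ck_on (k : nat) (O : set 'rV[R]_n) (f : 'rV[R]_n -> R) : Prop :=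
  (forall x, O x -> {for x, continuous f}) /\
  if k is k'.+1 then
    forall i : 'I_n,
      (forall x, O x -> derivable f x (delta_mx 0 i)) /\
      Ck_on k' O (fun x => 'D_(delta_mx 0 i) f x)
  else True.

Definition Cinf_on (O : set 'rV[R]_n) (f : 'rV[R]_n -> R) : Prop :=
  forall k, Ck_on k O f.

End Calculus.

(* The chart [chart_fun a] is only meaningful on the open set [chart_dom a],
   and [chart_inv a] only on its image. *)
Record smooth_atlas (R : realType) (n : nat) (M : topologicalType) := SmoothAtlas {
  chart_ix : Type;
  chart_dom : chart_ix -> set M;
  chart_fun : chart_ix -> M -> 'rV[R]_n;
  chart_inv : chart_ix -> 'rV[R]_n -> M;
  chart_dom_open : forall a, open (chart_dom a);
  chart_img_open : forall a, open (chart_fun a @` chart_dom a);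
  chart_funK : forall a p, chart_dom a p -> chart_inv a (chart_fun a p) = p;
  chart_fun_cont : forall a p, chart_dom a p -> {for p, continuous (chart_fun a)};
  chart_inv_cont : forall a x, (chart_fun a @` chart_dom a) x ->
    {for x, continuous (chart_inv a)};
  chart_cover : forall p, exists a, chart_dom a p;
  chart_smooth : forall a b (i : 'I_n),
    Cinf_on (chart_fun a @` (chart_dom a `&` chart_dom b))
            (fun x => chart_fun b (chart_inv a x) 0 i)
}.

Record manifold (R : realType) (n : nat) := Manifold {
  mcarrier :> topologicalType;
  matlas : smooth_atlas R n mcarrier;
  mhausdorff : hausdorff_space mcarrier;
  msecond_countable : @second_countable mcarrier
}.

Section Fields.
Variables (R : realType) (n : nat) (M : manifold R n).
Local Notation atlas := (matlas M).

Definition smooth_on (W : set M) (f : M -> R) : Prop :=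
  forall a : chart_ix atlas,
    Cinf_on (chart_fun a @` (chart_dom a `&` W)) (f \o chart_inv a).

Definition smooth_near (p : M) (f : M -> R) : Prop :=
  exists W : set M, [/\ open W, W p & smooth_on W f].

(* Tangent vectors at p are the derivations of the algebra of germs at p of
   smooth functions.  They are represented by functionals on all functions
   [M -> R]; requiring the value 0 on functions that are not smooth near p makes
   the representation unique, so that Leibniz equality is equality of tangent
   vectors. *)
Definition functional : Type := (M -> R) -> R^o.

Definition tangent (p : M) (v : functional) : Prop :=
  [/\ forall f, ~ smooth_near p f -> v f = 0,
      forall f h, smooth_near p f -> smooth_near p h ->
        (\forall q \near p, f q = h q) -> v f = v h,
      forall (c : R) f h, smooth_near p f -> smooth_near p h ->
        v (fun q => c * f q + h q) = c * v f + v h &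
      forall f h, smooth_near p f -> smooth_near p h ->
        v (fun q => f q * h q) = v f * h p + f p * v h].

(* A field is total on M; only its values on the open set where it is asserted
   to be a vector field matter. *)
Definition field : Type := M -> functional.

Definition vfield (U : set M) (X : field) : Prop :=
  (forall p, U p -> tangent p (X p)) /\
  (forall W f, open W -> W `<=` U -> smooth_on W f ->
     smooth_on W (fun p => X p f)).

Definition eq_on (U : set M) (X Y : field) : Prop :=
  forall p, U p -> X p = Y p.

(* The test on f only restores the normalisation required in [tangent]. *)
Definition lie (X Y : field) : field := fun p f =>
  if `[< smooth_near p f >]
  then X p (fun q => Y q f) - Y p (fun q => X q f) else 0.

Definition addf (X Y : field) : field := fun p f => X p f + Y p f.
Definition subf (X Y : field) : field := fun p f => X p f - Y p f.
Definition scalef (h : M -> R) (X : field) : field := fun p f => h p * X p f.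

(** * Semi-Riemannian metrics and connections *)

Definition metric_tensor : Type := M -> functional -> functional -> R.

Definition is_sign (eps : 'I_n -> R) : Prop :=
  forall i, eps i = 1 \/ eps i = -1.

(* Constancy of the signature is part of [spin_structure] below, whose local
   orthonormal frames all have the same signs. *)
Definition semi_riemannian (g : metric_tensor) : Prop :=
  [/\ forall p u v, tangent p u -> tangent p v -> g p u v = g p v u,
      forall p (c : R) u v w, tangent p u -> tangent p v -> tangent p w ->
        g p (fun f => c * u f + v f) w = c * g p u w + g p v w,
      forall p u, tangent p u -> (forall v, tangent p v -> g p u v = 0) ->
        u = (fun=> 0) &
      forall U X Y, open U -> vfield U X -> vfield U Y ->
        smooth_on U (fun p => g p (X p) (Y p))].

Definition orthonormal_frame (g : metric_tensor) (eps : 'I_n -> R)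
    (U : set M) (e : 'I_n -> field) : Prop :=
  [/\ is_sign eps,
      forall i, vfield U (e i),
      forall p, U p -> forall i j, g p (e i p) (e j p) = eps i *+ (i == j) &
      forall p, U p -> forall v, tangent p v ->
        exists c : 'I_n -> R, v = (fun f => \sum_i c i * e i p f)].

(* Covariant derivatives of vector fields are also needed for fields defined on
   open subsets only, hence the quantification over U and the locality clause. *)
Record is_connection (D : field -> field -> field) : Prop := IsConnection {
  conn_field : forall U X Y, open U -> vfield U X -> vfield U Y ->
    vfield U (D X Y);
  conn_local : forall U X X' Y Y', open U ->
    vfield U X -> vfield U X' -> vfield U Y -> vfield U Y' ->
    eq_on U X X' -> eq_on U Y Y' -> eq_on U (D X Y) (D X' Y');
  conn_addl : forall U X X' Y, open U ->
    vfield U X -> vfield U X' -> vfield U Y ->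
    eq_on U (D (addf X X') Y) (addf (D X Y) (D X' Y));
  conn_scalel : forall U h X Y, open U -> smooth_on U h ->
    vfield U X -> vfield U Y ->
    eq_on U (D (scalef h X) Y) (scalef h (D X Y));
  conn_addr : forall U X Y Y', open U ->
    vfield U X -> vfield U Y -> vfield U Y' ->
    eq_on U (D X (addf Y Y')) (addf (D X Y) (D X Y'));
  conn_leibniz : forall U h X Y, open U -> smooth_on U h ->
    vfield U X -> vfield U Y ->
    eq_on U (D X (scalef h Y))
            (addf (scalef (fun p => X p h) Y) (scalef h (D X Y)))
}.

Record levi_civita (g : metric_tensor) (D : field -> field -> field) : Prop :=
  LeviCivita {
    lc_connection : is_connection D;
    lc_torsion_free : forall U X Y, open U -> vfield U X -> vfield U Y ->
      eq_on U (subf (D X Y) (D Y X)) (lie X Y);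
    lc_metric : forall U X Y Z, open U ->
      vfield U X -> vfield U Y -> vfield U Z ->
      forall p, U p ->
        X p (fun q => g q (Y q) (Z q)) =
        g p (D X Y p) (Z p) + g p (Y p) (D X Z p)
  }.

Variables (g : metric_tensor) (D : field -> field -> field) (V : field).

Definition nablaV (X Y : field) : field := fun p f =>
  D X Y p f + g p (X p) (Y p) * V p f - g p (V p) (Y p) * X p f.

Definition curvV (X Y Z : field) : field :=
  subf (subf (nablaV X (nablaV Y Z)) (nablaV Y (nablaV X Z)))
       (nablaV (lie X Y) Z).

Definition ricV (eps : 'I_n -> R) (e : 'I_n -> field) (X Y : field) (p : M) : R :=
  \sum_i eps i * g p (curvV X (e i) (e i) p) (Y p).

(* Ric^V(X), as a vector field on U determined by Ric^V(X, -). *)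
Definition is_ric_vector (eps : 'I_n -> R) (e : 'I_n -> field) (U : set M)
    (X RicX : field) : Prop :=
  vfield U RicX /\
  forall W Y, open W -> W `<=` U -> vfield W Y ->
    forall p, W p -> g p (RicX p) (Y p) = ricV eps e X Y p.

(* 2-forms and 3-forms, as functions of vector fields evaluated at a point;
   u /\ v is the wedge product of the 1-forms dual to u and v, without
   normalising factors: (a /\ b)(Y, Z) = a(Y) b(Z) - a(Z) b(Y). *)
Definition form2 : Type := field -> field -> M -> R.
Definition form3 : Type := field -> field -> field -> M -> R.

Definition wedge11 (A B : field) : form2 := fun Y Z p =>
  g p (A p) (Y p) * g p (B p) (Z p) - g p (A p) (Z p) * g p (B p) (Y p).

Definition dflat : form2 := fun Y Z p =>
  g p (D Y V p) (Z p) - g p (D Z V p) (Y p).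

Definition wedge21 (w : form2) (A : field) : form3 := fun X Y Z p =>
  w X Y p * g p (A p) (Z p) + w Y Z p * g p (A p) (X p)
  + w Z X p * g p (A p) (Y p).

End Fields.

(** * Spin structures and spinor fields *)

(* Complex dimension of the spinor module. *)
Definition spin_dim (n : nat) : nat := 2 ^ n./2.

Section Spin.
Variables (R : realType) (n : nat).
Local Notation C := (R[i]).
Local Notation N := (spin_dim n).

Local Notation realC := (real_complex R).

(* A complex module of dimension 2 ^ (n./2) over the Clifford algebra with
   v . v = - g(v, v): the irreducible one, unique up to isomorphism for n even
   and one of two choices for n odd. *)
Definition clifford_module (eps : 'I_n -> R) (gam : 'I_n -> 'M[C]_N) : Prop :=
  forall i j, gam i *m gam j + gam j *m gam i
              = (realC (- (eps i *+ (i == j)) *+ 2))%:M.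

Definition clif (gam : 'I_n -> 'M[C]_N) (v : 'rV[R]_n) : 'M[C]_N :=
  \sum_i realC (v 0 i) *: gam i.

(* The group Spin(r, s) of products of an even number of vectors of square
   +1 or -1.  It acts faithfully on the spinor module and is identified with
   its image in GL(N, C). *)
Definition spin_group (eps : 'I_n -> R) (gam : 'I_n -> 'M[C]_N) : set 'M[C]_N :=
  [set S | exists s : seq 'rV[R]_n,
     [/\ ~~ odd (size s),
         forall v, v \in s ->
           \sum_i eps i * v 0 i ^+ 2 = 1 \/ \sum_i eps i * v 0 i ^+ 2 = -1 &
         S = \big[mulmx/1%:M]_(v <- s) clif gam v]].

Variable (M : manifold R n) (g : metric_tensor M).

Definition csmooth_on (W : set M) (F : M -> C) : Prop :=
  smooth_on W (fun q => complex.Re (F q)) /\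
  smooth_on W (fun q => complex.Im (F q)).

(* The signature eps of g together with the spinor module and a spin
   structure, given by local trivialisations: oriented orthonormal frames
   [sframe a] on the open sets [sdom a] and a Spin(r, s)-valued cocycle lifting
   the SO(r, s)-valued transition functions between these frames, along the
   covering S |-> (v |-> S v S^-1). *)
Record spin_structure := SpinStructure {
  seps : 'I_n -> R;
  sgam : 'I_n -> 'M[C]_N;
  sgamP : clifford_module seps sgam;
  six : Type;
  sdom : six -> set M;
  sframe : six -> 'I_n -> field M;
  strans : six -> six -> M -> 'M[C]_N;
  sdom_open : forall a, open (sdom a);
  sdom_cover : forall p, exists a, sdom a p;
  sframeP : forall a, orthonormal_frame g seps (sdom a) (sframe a);
  strans_smooth : forall a b k l,
    csmooth_on (sdom a `&` sdom b) (fun p => strans a b p k l);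
  strans_spin : forall a b p, sdom a p -> sdom b p ->
    spin_group seps sgam (strans a b p);
  strans_id : forall a p, sdom a p -> strans a a p = 1%:M;
  strans_cocycle : forall a b c p, sdom a p -> sdom b p -> sdom c p ->
    strans a b p *m strans b c p = strans a c p;
  strans_lift : forall a b p, sdom a p -> sdom b p -> forall j,
    strans a b p *m sgam j =
    clif sgam (\row_i (seps i * g p (sframe b j p) (sframe a i p)))
      *m strans a b p
}.

Variable (T : spin_structure).

(* Sections of the spinor bundle; [psi a] are the components in the
   trivialisation a. *)
Definition sections : Type := six T -> M -> 'cV[C]_N.

Definition spinor_field (psi : sections) : Prop :=
  (forall a k, csmooth_on (sdom a) (fun p => psi a p k 0)) /\
  (forall a b p, sdom a p -> sdom b p -> psi a p = strans a b p *m psi b p).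

(* Clifford multiplication by vectors, 2-forms and 3-forms at p, in the
   trivialisation a.  The e_i being orthogonal, e_i /\ e_j acts for i < j as
   e_i . e_j, and likewise for i < j < k; this is the extension of Clifford
   multiplication to forms for which X . w = X /\ w - X _| w. *)
Definition clv (a : six T) (p : M) (v : functional M) : 'M[C]_N :=
  clif (sgam T) (\row_i (seps T i * g p v (sframe a i p))).

Definition cl2 (a : six T) (p : M) (w : form2 M) : 'M[C]_N :=
  \sum_(i < n) \sum_(j < n | (i < j)%N)
    realC (seps T i * seps T j * w (sframe a i) (sframe a j) p)
      *: (sgam T i *m sgam T j).

Definition cl3 (a : six T) (p : M) (w : form3 M) : 'M[C]_N :=
  \sum_(i < n) \sum_(j < n | (i < j)%N) \sum_(k < n | (j < k)%N)
    realC (seps T i * seps T j * seps T k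
           * w (sframe a i) (sframe a j) (sframe a k) p)
      *: (sgam T i *m sgam T j *m sgam T k).

Definition dspin (v : functional M) (F : M -> 'cV[C]_N) : 'cV[C]_N :=
  \col_k ((v (fun q => complex.Re (F q k 0)))
          +i* (v (fun q => complex.Im (F q k 0))))%C.

Variables (D : field M -> field M -> field M) (V : field M).

(* The lift of the Levi-Civita connection in the frame e = sframe a:
   X(psi) + 1/2 sum_(i<j) eps_i eps_j g(D_X e_i, e_j) e_i . e_j . psi. *)
Definition nablaS_LC (X : field M) (psi : sections) : sections := fun a p =>
  dspin (X p) (psi a)
  + (\sum_(i < n) \sum_(j < n | (i < j)%N)
       realC (2^-1 * (seps T i * seps T j
                      * g p (D X (sframe a i) p) (sframe a j p)))
         *: (sgam T i *m sgam T j)) *m psi a p.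

Definition nablaS (X : field M) (psi : sections) : sections := fun a p =>
  nablaS_LC X psi a p + realC 2^-1 *: (cl2 a p (wedge11 g X V) *m psi a p).

Definition curvS (X Y : field M) (psi : sections) : sections := fun a p =>
  nablaS X (nablaS Y psi) a p - nablaS Y (nablaS X psi) a p
  - nablaS (lie X Y) psi a p.

End Spin.

(* Main.v *)
(* Let s be the frame of the trivialisation and w_ij(X) = g(nabla_X s_i, s_j).
   In it nabla_X psi = X(psi) + 1/2 sum_(i<j) eps_i eps_j w_ij(X) s_i.s_j.psi, and,
   nabla being metric, the commutator of quadratic Clifford elements turns the
   spinorial curvature into
     R(X, Y) psi = 1/2 sum_(i<j) eps_i eps_j g(R(X, Y) s_i, s_j) s_i.s_j.psi.
   Contracting with s_k, the terms k = i and k = j give - 1/2 Ric(X), and the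
   others the cyclic sum of g(R(X, s_k) s_i, s_j) over k, i, j.  Writing R as the
   Riemannian curvature (whose cyclic sum vanishes) plus an explicit expression
   in V and D V identifies this cyclic sum with dV /\ X. *)
Require Import Defs.
From mathcomp Require Import all_boot all_order all_algebra.
From mathcomp Require Import all_classical all_reals all_analysis.
From mathcomp Require Import complex zify ring lra.
Set Implicit Arguments.
Unset Strict Implicit.
Unset Printing Implicit Defensive.
Import Order.TTheory GRing.Theory Num.Theory.
Import numFieldNormedType.Exports.
Local Open Scope classical_set_scope.
Local Open Scope ring_scope.

(** * Smooth functions and tangent vectors *)

Section SmoothCalculus.
Variables (R : realType) (n : nat).
Implicit Types (O : set 'rV[R]_n) (f h : 'rV[R]_n -> R).

(** Two frames are in play: the frame e of the statement, with its own signs, and the frame s of the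
    trivialisation, in which Clifford multiplication and spinor derivatives are written. The
    contraction over e is carried over to s, which requires the curvature of nabla to be linear over
    functions in its second and third slots. This is obtained without differentiating the
    coefficients, from the symmetries of the Riemannian curvature and of metric connections.
    Curvatures are compared as scalars g(R(X, Y)Z, W): compatibility with g trades each second
    covariant derivative for the derivative of a function, so the torsion correction of one nabla
    never has to be inserted into another. *)

Lemma Ck_on_sub k O O' f : O' `<=` O -> Ck_on k O f -> Ck_on k O' f.
Proof.
move=> sO; elim: k f => [|k IH] f [cf df]; split=> //; first by move=> x /sO/cf.
  by move=> x /sO/cf.
move=> i; have [d1 d2] := df i.
by split=> [x /sO/d1//|]; exact: IH.
Qed.

Lemma Ck_on_ext k O f h : open O -> (forall x, O x -> f x = h x) ->
  Ck_on k O f -> Ck_on k O h.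
Proof.
move=> oO fh.
have nfh f' h' x : (forall y, O y -> f' y = h' y) -> O x -> \near x, f' x = h' x.
  by move=> fh' Ox; near=> y; apply: fh'; near: y; exact: open_nbhs_nbhs.
have cts f' h' : (forall y, O y -> f' y = h' y) ->
    (forall x, O x -> {for x, continuous f'}) ->
    (forall x, O x -> {for x, continuous h'}).
  move=> fh' cf' x Ox; rewrite /prop_for /continuous_at -(fh' x)//.
  by apply: cvg_trans (cf' x Ox); apply: (@near_eq_cvg _ _ (nbhs x)); exact: nfh.
elim: k f h fh => [|k IH] f h fh [cf df]; split=> //; do ?exact: cts cf.
move=> i.
have [d1 d2] := df i; split=> [x Ox|].
  by apply: near_eq_derivable (d1 x Ox); exact: nfh.
by apply: IH d2 => x Ox; apply: near_eq_derive; exact: nfh.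
Unshelve. all: by end_near. Qed.

(** For the product rule: a derivative of f h contains f and h undifferentiated, which must then be
    known at the lower order. *)
Lemma Ck_onW k O f : Ck_on k.+1 O f -> Ck_on k O f.
Proof.
elim: k f => [|k IH] f [cf df]; split=> // i.
by have [d1 d2] := df i; split=> //; exact: IH.
Qed.

Lemma Ck_on_cst k O (c : R) : open O -> Ck_on k O (fun=> c).
Proof.
have cc (c' : R) x : O x -> {for x, continuous (fun=> c' : R)}.
  by move=> _; exact: cst_continuous.
move=> oO; elim: k c => [|k IH] c; split=> //; do ?by move=> x /cc.
move=> i; split=> [x _|]; first exact: derivable_cst.
apply: (@Ck_on_ext k O (fun=> 0)) => // x _.
symmetry; exact: derive_cst.
Qed.

Lemma Ck_onD k O f h : open O -> Ck_on k O f -> Ck_on k O h ->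
  Ck_on k O (fun x => f x + h x).
Proof.
move=> oO; elim: k f h => [|k IH] f h [cf df] [ch dh].
  by split=> // x Ox; exact: (cvgD (cf x Ox) (ch x Ox)).
split=> [x Ox|i]; first by exact: (cvgD (cf x Ox) (ch x Ox)).
have [f1 f2] := df i; have [h1 h2] := dh i.
split=> [x Ox|]; first by apply: derivableD; [exact: f1 | exact: h1].
apply: Ck_on_ext (IH _ _ f2 h2) => // x Ox.
by rewrite -deriveD//; [exact: f1 | exact: h1].
Qed.

Lemma Ck_onM k O f h : open O -> Ck_on k O f -> Ck_on k O h ->
  Ck_on k O (fun x => f x * h x).
Proof.
move=> oO; elim: k f h => [|k IH] f h [cf df] [ch dh].
  by split=> // x Ox; exact: (cvgM (cf x Ox) (ch x Ox)).
split=> [x Ox|i]; first by exact: (cvgM (cf x Ox) (ch x Ox)).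
have [f1 f2] := df i; have [h1 h2] := dh i.
split=> [x Ox|]; first by apply: derivableM; [exact: f1 | exact: h1].
have kf : Ck_on k O f by apply: Ck_onW; split.
have kh : Ck_on k O h by apply: Ck_onW; split.
apply: Ck_on_ext (Ck_onD oO (IH _ _ kf h2) (IH _ _ kh f2)) => // x Ox.
by rewrite deriveM//; [exact: f1 | exact: h1].
Qed.

End SmoothCalculus.

Section SmoothFunctions.
Variables (R : realType) (n : nat) (M : manifold R n).
Implicit Types (W : set M) (f h : M -> R).
Local Notation atlas := (matlas M).

Lemma chart_img_open_sub (a : chart_ix atlas) W : open W ->
  open (chart_fun a @` (chart_dom a `&` W)).
Proof.
move=> oW; rewrite openE => _ [q [aq Wq] <-].
have iq : (chart_fun a @` chart_dom a) (chart_fun a q) by exists q.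
have n1 : nbhs (chart_fun a q) (chart_fun a @` chart_dom a).
  by apply: open_nbhs_nbhs; split=> //; exact: chart_img_open.
have n2 : nbhs (chart_fun a q) (chart_inv a @^-1` W).
  apply: (chart_inv_cont iq); rewrite chart_funK//.
  exact: open_nbhs_nbhs.
apply: filterS2 n1 n2 => x [q' aq' <-]; rewrite /preimage/= chart_funK// => Wq'.
by exists q'.
Qed.

Lemma smooth_on_sub W W' f : W' `<=` W -> smooth_on W f -> smooth_on W' f.
Proof.
move=> sW sf a k; apply: Ck_on_sub (sf a k).
by move=> _ [q [aq /sW Wq] <-]; exists q.
Qed.

Lemma smooth_on_ext W f h : open W -> (forall q, W q -> f q = h q) ->
  smooth_on W f -> smooth_on W h.
Proof.
move=> oW fh sf a k; apply: Ck_on_ext (sf a k).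
  exact: chart_img_open_sub.
by move=> _ [q [aq Wq] <-] /=; rewrite chart_funK// fh.
Qed.

Lemma smooth_on_cst W (c : R) : open W -> smooth_on W (fun=> c : R).
Proof. by move=> oW a k; apply: Ck_on_cst; exact: chart_img_open_sub. Qed.

Lemma smooth_onD W f h : open W -> smooth_on W f -> smooth_on W h ->
  smooth_on W (fun q => f q + h q).
Proof.
move=> oW sf sh a k; apply: Ck_onD (sf a k) (sh a k).
exact: chart_img_open_sub.
Qed.

Lemma smooth_onM W f h : open W -> smooth_on W f -> smooth_on W h ->
  smooth_on W (fun q => f q * h q).
Proof.
move=> oW sf sh a k; apply: Ck_onM (sf a k) (sh a k).
exact: chart_img_open_sub.
Qed.

Lemma smooth_onN W f : open W -> smooth_on W f -> smooth_on W (fun q => - f q).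
Proof.
move=> oW sf; apply: smooth_on_ext (smooth_onM oW (smooth_on_cst (-1) oW) sf) => //.
by move=> q _; rewrite mulN1r.
Qed.

Lemma smooth_onB W f h : open W -> smooth_on W f -> smooth_on W h ->
  smooth_on W (fun q => f q - h q).
Proof. by move=> oW sf sh; apply: smooth_onD => //; exact: smooth_onN. Qed.

Lemma smooth_on_near W f p : open W -> W p -> smooth_on W f -> smooth_near p f.
Proof. by exists W. Qed.

Section TangentVector.
Variables (W : set M) (p : M) (v : functional M).
Hypotheses (oW : open W) (Wp : W p) (tv : tangent p v).
Let near_p f (sf : smooth_on W f) : smooth_near p f := smooth_on_near oW Wp sf.

Lemma tangent_ext f h : smooth_on W f -> (forall q, W q -> f q = h q) ->
  v f = v h.
Proof.
move=> sf fh; case: tv => _ loc _ _; apply: loc; first exact: near_p.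
  by apply: near_p; exact: smooth_on_ext sf.
by near=> q; apply: fh; near: q; exact: open_nbhs_nbhs.
Unshelve. all: by end_near. Qed.

Lemma tangentD f h : smooth_on W f -> smooth_on W h ->
  v (fun q => f q + h q) = v f + v h.
Proof.
move=> sf sh; case: tv => _ _ lin _.
rewrite -[v f]mul1r -lin; [|exact: near_p..].
by congr (v _); apply/funext => q; rewrite mul1r.
Qed.

Lemma tangentM f h : smooth_on W f -> smooth_on W h ->
  v (fun q => f q * h q) = v f * h p + f p * v h.
Proof. by move=> sf sh; case: tv => _ _ _; apply; exact: near_p. Qed.

Lemma tangent_cst (c : R) : v (fun=> c) = 0.
Proof.
have s1 d := smooth_on_cst d oW.
have v1 : v (fun=> 1) = 0.
  have := tangentM (s1 1) (s1 1); rewrite !mulr1 mul1r.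
  by move/eqP; rewrite -subr_eq0 opprD addrA subrr sub0r oppr_eq0 => /eqP.
have v0 : v (fun=> 0) = 0.
  have := tangentD (s1 0) (s1 0); rewrite addr0.
  by move/eqP; rewrite -subr_eq0 opprD addrA subrr sub0r oppr_eq0 => /eqP.
case: tv => _ _ lin _; have := lin c _ _ (near_p (s1 1)) (near_p (s1 0)).
by rewrite v1 v0 mulr0 !addr0 mulr1.
Qed.

Lemma tangentZ (c : R) f : smooth_on W f -> v (fun q => c * f q) = c * v f.
Proof.
by move=> sf; rewrite tangentM ?tangent_cst ?mul0r ?add0r//; exact: smooth_on_cst.
Qed.

Lemma tangentN f : smooth_on W f -> v (fun q => - f q) = - v f.
Proof.
move=> sf; rewrite -mulN1r -tangentZ//.
by congr (v _); apply/funext => q; rewrite mulN1r.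
Qed.

Lemma tangentB f h : smooth_on W f -> smooth_on W h ->
  v (fun q => f q - h q) = v f - v h.
Proof. by move=> sf sh; rewrite tangentD ?tangentN//; exact: smooth_onN. Qed.

End TangentVector.

End SmoothFunctions.

(** * Vector fields and metrics *)

Section VectorFields.
Variables (R : realType) (n : nat) (M : manifold R n).
Implicit Types (U W : set M) (X Y Z : field M).

Lemma tangent0 (p : M) : tangent p (fun=> 0 : R^o).
Proof.
by split=> // *; rewrite ?mulr0 ?mul0r addr0.
Qed.

Lemma tangent_lin (p : M) (c : R) (u v : functional M) :
  tangent p u -> tangent p v -> tangent p (fun f => c * u f + v f).
Proof.
move=> [u1 u2 u3 u4] [v1 v2 v3 v4]; split=> [f nf|f h sf sh fh|d f h sf sh|f h sf sh].
- by rewrite u1// v1// mulr0 addr0.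
- by rewrite (u2 f h)// (v2 f h).
- by rewrite u3// v3//; ring.
- by rewrite u4// v4//; ring.
Qed.

Lemma tangent_add (p : M) (u v : functional M) :
  tangent p u -> tangent p v -> tangent p (fun f => u f + v f).
Proof.
move=> tu tv; have -> : (fun f => u f + v f) = (fun f => 1 * u f + v f).
  by apply/funext => f; rewrite mul1r.
exact: tangent_lin.
Qed.

Lemma tangent_scale (p : M) (c : R) (u : functional M) :
  tangent p u -> tangent p (fun f => c * u f).
Proof.
move=> tu; have -> : (fun f => c * u f) = (fun f => c * u f + 0).
  by apply/funext => f; rewrite addr0.
by apply: tangent_lin => //; exact: tangent0.
Qed.

Lemma vfield_sub U U' X : U' `<=` U -> vfield U X -> vfield U' X.
Proof.
move=> sU [tX sX]; split=> [p /sU/tX//|W f oW sW]; apply: sX => //.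
exact: subset_trans sU.
Qed.

Lemma vfield_ext U X Y : eq_on U X Y -> vfield U X -> vfield U Y.
Proof.
move=> XY [tX sX]; split=> [p Up|W f oW sW sf]; first by rewrite -XY//; exact: tX.
apply: smooth_on_ext (sX W f oW sW sf) => // q Wq.
by rewrite XY//; exact: sW.
Qed.

Lemma vfieldD U X Y : vfield U X -> vfield U Y -> vfield U (Defs.addf X Y).
Proof.
move=> [tX sX] [tY sY]; split=> [p Up|W f oW sW sf].
  by apply: tangent_add; [exact: tX | exact: tY].
by apply: smooth_onD => //; [exact: sX | exact: sY].
Qed.

Lemma vfieldZ U (h : M -> R) X : smooth_on U h -> vfield U X -> vfield U (scalef h X).
Proof.
move=> sh [tX sX]; split=> [p Up|W f oW sW sf].
  by apply: tangent_scale; exact: tX.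
by apply: smooth_onM => //; [exact: smooth_on_sub sh | exact: sX].
Qed.

Lemma vfield0 U : vfield U (fun _ _ => 0).
Proof. by split=> [p _|W f oW _ _]; [exact: tangent0 | exact: smooth_on_cst]. Qed.

Lemma vfieldB U X Y : open U -> vfield U X -> vfield U Y -> vfield U (subf X Y).
Proof.
move=> oU vX vY.
apply: (@vfield_ext _ (Defs.addf X (scalef (fun=> -1) Y))).
  by move=> p Up; apply/funext => f; rewrite /Defs.addf /scalef /subf mulN1r.
by apply: vfieldD => //; apply: vfieldZ => //; exact: smooth_on_cst.
Qed.

Lemma vfield_smooth U X f : open U -> vfield U X -> smooth_on U f ->
  smooth_on U (fun p => X p f).
Proof. by move=> oU [_ sX]; exact: sX. Qed.

Lemma lieE U X Y p f : open U -> U p -> smooth_on U f ->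
  lie X Y p f = X p (fun q => Y q f) - Y p (fun q => X q f).
Proof. by move=> oU Up sf; rewrite /lie asboolT//; exact: smooth_on_near sf. Qed.

Lemma lie_jacobi U X Y Z p f : open U ->
  vfield U X -> vfield U Y -> vfield U Z -> U p ->
  lie X (lie Y Z) p f + lie Y (lie Z X) p f + lie Z (lie X Y) p f = 0.
Proof.
move=> oU vX vY vZ Up.
(* If f is not smooth near p, the normalisation in [lie] makes all three brackets 0. Otherwise f is
   smooth on a neighbourhood, and the brackets expand into second derivatives of f that cancel. *)
have [[W [oW Wp sf]]|nf] := pselect (smooth_near p f); last first.
  by rewrite /lie !asboolF// !addr0.
have oO := openI oU oW; set O := _ `&` _ in oO.
have Op : O p by [].
have {}sf : smooth_on O f by apply: smooth_on_sub sf => q [].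
have vO A : vfield U A -> vfield O A by apply: vfield_sub => q [].
have step A B C' : vfield U A -> vfield U B -> vfield U C' ->
    lie A (lie B C') p f =
    A p (fun q => B q (fun r => C' r f)) - A p (fun q => C' q (fun r => B r f))
    - (B p (fun q => C' q (fun r => A r f)) - C' p (fun q => B q (fun r => A r f))).
  move=> /vO vA /vO vB /vO vC.
  have sA := vfield_smooth oO vA sf.
  have sBC := vfield_smooth oO vB (vfield_smooth oO vC sf).
  have sCB := vfield_smooth oO vC (vfield_smooth oO vB sf).
  rewrite (lieE _ _ oO Op sf) (lieE _ _ oO Op sA); congr (_ - _).
  have tA : tangent p (A p) by case: vA => + _; exact.
  rewrite -(tangentB oO Op tA sBC sCB).
  apply/esym/(tangent_ext oO Op tA); first exact: smooth_onB.
  by move=> q Oq; rewrite (lieE _ _ oO Oq sf).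
rewrite !step//; ring.
Qed.

End VectorFields.

Section Metric.
Variables (R : realType) (n : nat) (M : manifold R n).
Variables (g : metric_tensor M) (hg : semi_riemannian g).
Implicit Types (U W : set M) (X Y Z : field M) (u v w : functional M) (p : M).

Lemma metricC p u v : tangent p u -> tangent p v -> g p u v = g p v u.
Proof. by case: hg => + _ _ _; exact. Qed.

Lemma metric_linl p c u v w : tangent p u -> tangent p v -> tangent p w ->
  g p (fun f => c * u f + v f) w = c * g p u w + g p v w.
Proof. by case: hg => _ + _ _; exact. Qed.

Lemma metricDl p u v w : tangent p u -> tangent p v -> tangent p w ->
  g p (fun f => u f + v f) w = g p u w + g p v w.
Proof.
move=> tu tv tw; rewrite -[g p u w]mul1r -metric_linl//.
by congr (g p _ w); apply/funext => f; rewrite mul1r.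
Qed.

Lemma metric0l p w : tangent p w -> g p (fun=> 0) w = 0.
Proof.
move=> tw; have := metricDl (tangent0 p) (tangent0 p) tw.
rewrite addr0 => /eqP.
by rewrite -subr_eq0 opprD addrA subrr sub0r oppr_eq0 => /eqP.
Qed.

Lemma metricZl p c u w : tangent p u -> tangent p w ->
  g p (fun f => c * u f) w = c * g p u w.
Proof.
move=> tu tw; rewrite -[RHS]addr0 -[X in _ + X](metric0l tw) -metric_linl//.
  by congr (g p _ w); apply/funext => f; rewrite addr0.
exact: tangent0.
Qed.

Lemma metricBl p u v w : tangent p u -> tangent p v -> tangent p w ->
  g p (fun f => u f - v f) w = g p u w - g p v w.
Proof.
move=> tu tv tw; rewrite addrC -mulN1r -metric_linl//.
by congr (g p _ w); apply/funext => f; rewrite mulN1r addrC.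
Qed.

Lemma tangent_sum p (I : Type) (r : seq I) (c : I -> R) (u : I -> functional M) :
  (forall i, tangent p (u i)) -> tangent p (fun f => \sum_(i <- r) c i * u i f).
Proof.
move=> tu; elim: r => [|i r IH].
  under eq_fun do rewrite big_nil; exact: tangent0.
under eq_fun do rewrite big_cons; exact: tangent_lin.
Qed.

Lemma metric_suml p (I : Type) (r : seq I) (c : I -> R) (u : I -> functional M) w :
  (forall i, tangent p (u i)) -> tangent p w ->
  g p (fun f => \sum_(i <- r) c i * u i f) w = \sum_(i <- r) c i * g p (u i) w.
Proof.
move=> tu tw; elim: r => [|i r IH].
  under eq_fun do rewrite big_nil; by rewrite big_nil metric0l.
under eq_fun do rewrite big_cons.
by rewrite metric_linl// ?IH ?big_cons//; exact: tangent_sum.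
Qed.

Lemma metric_smooth U X Y : open U -> vfield U X -> vfield U Y ->
  smooth_on U (fun p => g p (X p) (Y p)).
Proof. by case: hg => _ _ _; exact. Qed.

Section OrthonormalFrame.
Variables (eps : 'I_n -> R) (U : set M) (e : 'I_n -> field M).
Hypothesis he : orthonormal_frame g eps U e.

Lemma frame_vfield i : vfield U (e i).
Proof. by case: he. Qed.

Lemma frame_tangent p i : U p -> tangent p (e i p).
Proof. by case: (frame_vfield i) => + _; exact. Qed.

Lemma sign_sqr i : eps i * eps i = 1.
Proof. by case: he => /(_ i) [] -> _ _ _; rewrite ?mulrNN mulr1. Qed.

Lemma frame_ortho p i j : U p -> g p (e i p) (e j p) = eps i *+ (i == j).
Proof. by case: he => _ _ ho _ Up; exact: ho. Qed.

(** Pairing with [e i] isolates the i-th coefficient up to the sign [eps i], which is its own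
    inverse. *)
Lemma frame_expand p u : U p -> tangent p u ->
  u = (fun f => \sum_i (eps i * g p u (e i p)) * e i p f).
Proof.
move=> Up tu; case: he => _ _ _ /(_ p Up u tu) [c uE].
rewrite {1}uE; apply/funext => f; apply: eq_bigr => i _; congr (_ * _).
rewrite uE metric_suml; [|by move=> j; exact: frame_tangent|exact: frame_tangent].
rewrite (bigD1 i)//= big1 => [|j ji]; last first.
  by rewrite frame_ortho// (negbTE ji) mulr0.
by rewrite frame_ortho// eqxx addr0 mulrCA sign_sqr mulr1.
Qed.

(** Serves twice: to write products of covariant derivatives through connection coefficients, and to
    get the Gram relation between two orthonormal frames. *)
Lemma frame_parseval p u v : U p -> tangent p u -> tangent p v ->
  \sum_i eps i * (g p (e i p) u * g p (e i p) v) = g p u v.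
Proof.
move=> Up tu tv; rewrite {2}(frame_expand Up tu) metric_suml//; last first.
  by move=> i; exact: frame_tangent.
apply: eq_bigr => i _.
by rewrite -mulrA [g p u _]metricC//; exact: frame_tangent.
Qed.

End OrthonormalFrame.

End Metric.

(** * Curvature of metric connections *)

(** [curvV g D V] is convertible to this with N the connection with torsion, so one set of lemmas
    covers both it and the Levi-Civita connection. *)
Definition curvature (R : realType) (n : nat) (M : manifold R n)
    (N : field M -> field M -> field M) (X Y Z : field M) : field M :=
  subf (subf (N X (N Y Z)) (N Y (N X Z))) (N (lie X Y) Z).

(* Closure of vector fields under brackets does not involve N; it is a field of
   the record because its proof goes through a torsion-free connection, while
   nabla, to which the record is also applied, has torsion. *)
Record metric_connection (R : realType) (n : nat) (M : manifold R n)
    (g : metric_tensor M) (N : field M -> field M -> field M) : Prop :=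
  MetricConnection {
    metric_conn_field : forall (U : set M) (X Y : field M), open U ->
      vfield U X -> vfield U Y -> vfield U (N X Y);
    metric_conn_lie : forall (U : set M) (X Y : field M), open U ->
      vfield U X -> vfield U Y -> vfield U (lie X Y);
    metric_conn_metric : forall (U : set M) (X Y Z : field M), open U ->
      vfield U X -> vfield U Y -> vfield U Z ->
      forall p, U p ->
        X p (fun q => g q (Y q) (Z q)) =
        g p (N X Y p) (Z p) + g p (Y p) (N X Z p)
  }.

Section MetricConnections.
Variables (R : realType) (n : nat) (M : manifold R n).
Variables (g : metric_tensor M) (hg : semi_riemannian g).
Variables (N : field M -> field M -> field M) (hN : metric_connection g N).
Variables (U : set M) (oU : open U) (p : M) (Up : U p).

Let vN X Y := metric_conn_field hN (X := X) (Y := Y) oU.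
Let vL X Y := metric_conn_lie hN (X := X) (Y := Y) oU.

Lemma vfield_curvature X Y Z : vfield U X -> vfield U Y -> vfield U Z ->
  vfield U (curvature N X Y Z).
Proof.
move=> vX vY vZ; apply: vfieldB => //; last by apply: vN => //; exact: vL.
by apply: vfieldB => //; apply: vN => //; exact: vN.
Qed.

(** Compatibility gives g(N_X N_Y Z, W) = X g(N_Y Z, W) - g(N_Y Z, N_X W), which leaves only fields
    differentiated once. *)
Lemma curvature_metric X Y Z W :
  vfield U X -> vfield U Y -> vfield U Z -> vfield U W ->
  g p (curvature N X Y Z p) (W p) =
    (X p (fun q => g q (N Y Z q) (W q)) - g p (N Y Z p) (N X W p))
    - (Y p (fun q => g q (N X Z q) (W q)) - g p (N X Z p) (N Y W p))
    - g p (N (lie X Y) Z p) (W p).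
Proof.
move=> vX vY vZ vW.
have t A : vfield U A -> tangent p (A p) by move=> [+ _]; exact.
rewrite (metric_conn_metric hN oU vX (vN vY vZ) vW Up).
rewrite (metric_conn_metric hN oU vY (vN vX vZ) vW Up) !addrK.
have tXYZ := t _ (vN vX (vN vY vZ)); have tYXZ := t _ (vN vY (vN vX vZ)).
have tL := t _ (vN (vL vX vY) vZ).
rewrite -(metricBl hg tXYZ tYXZ (t _ vW)).
rewrite -(metricBl hg _ tL (t _ vW))//.
by apply: (t (subf _ _)); apply: vfieldB => //; apply: vN => //; exact: vN.
Qed.

(** In the part symmetric in Z and W the products of first derivatives cancel, and what remains is X
    Y - Y X - [X, Y] applied to the function g(Z, W), which is 0. *)
Lemma curvature_skew X Y Z W :
  vfield U X -> vfield U Y -> vfield U Z -> vfield U W ->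
  g p (curvature N X Y Z p) (W p) = - g p (curvature N X Y W p) (Z p).
Proof.
move=> vX vY vZ vW.
have t A q : U q -> vfield U A -> tangent q (A q) by move=> Uq [+ _]; exact.
have sg A B (vA : vfield U A) (vB : vfield U B) := metric_smooth hg oU vA vB.
have step A B : vfield U A -> vfield U B ->
    A p (fun q => g q (N B Z q) (W q)) + A p (fun q => g q (N B W q) (Z q)) =
    A p (fun q => B q (fun r => g r (Z r) (W r))).
  move=> vA vB; rewrite -(tangentD oU Up (t _ _ Up vA))//; [|exact: sg (vN _ _) _..].
  apply: (tangent_ext oU Up (t _ _ Up vA)).
    by apply: smooth_onD => //; exact: sg (vN _ _) _.
  move=> q Uq; rewrite (metric_conn_metric hN oU vB vZ vW Uq).
  by rewrite [g q (Z q) _]metricC//; apply: t => //; exact: vN.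
have s1 := step _ _ vX vY; have s2 := step _ _ vY vX.
have s3 := lieE X Y oU Up (sg _ _ vZ vW).
rewrite (metric_conn_metric hN oU (vL vX vY) vZ vW Up) in s3.
rewrite !curvature_metric//.
rewrite [g p (N Y W p) _]metricC//; [|by apply: t => //; exact: vN..].
rewrite [g p (N X W p) _]metricC//; [|by apply: t => //; exact: vN..].
rewrite [g p (N (lie X Y) W p) _]metricC//; last 2 first.
- by apply: t => //; apply: vN => //; exact: vL.
- exact: t.
lra.
Qed.

End MetricConnections.

(** * Symmetries of the Riemannian curvature *)

Section LeviCivita.
Variables (R : realType) (n : nat) (M : manifold R n).
Variables (g : metric_tensor M) (hg : semi_riemannian g).
Variables (D : field M -> field M -> field M) (hD : levi_civita g D).

Lemma levi_civita_metric : metric_connection g D.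
Proof.
have [hc ht hm] := hD.
have vD := conn_field hc.
split=> // U X Y oU vX vY.
by apply: (vfield_ext (ht _ _ _ oU vX vY)); apply: vfieldB => //; exact: vD.
Qed.

Variables (U : set M) (oU : open U) (p : M) (Up : U p).
Let vD X Y := metric_conn_field levi_civita_metric (X := X) (Y := Y) oU.
Let vL X Y := metric_conn_lie levi_civita_metric (X := X) (Y := Y) oU.

Lemma lc_bracket X Y f : vfield U X -> vfield U Y ->
  lie X Y p f = D X Y p f - D Y X p f.
Proof. by move=> vX vY; rewrite -(lc_torsion_free hD oU vX vY Up). Qed.

(** Vanishing torsion is used twice in [step]: to exchange B and C' under D_A, then to exchange A
    with [B, C']. In the cyclic sum all covariant derivatives cancel and the Jacobi identity
    remains. *)
Lemma bianchi X Y Z f : vfield U X -> vfield U Y -> vfield U Z ->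
  curvature D X Y Z p f + curvature D Y Z X p f + curvature D Z X Y p f = 0.
Proof.
move=> vX vY vZ; have [hc ht _] := hD.
have step A B C' : vfield U A -> vfield U B -> vfield U C' ->
    D A (D B C') p f = D A (D C' B) p f + (D (lie B C') A p f + lie A (lie B C') p f).
  move=> vA vB vC.
  have -> : D A (D B C') p = D A (Defs.addf (D C' B) (lie B C')) p.
    apply: (conn_local hc oU) => //; first exact: vD.
      by apply: vfieldD; [exact: vD | exact: vL].
    move=> q Uq; apply/funext => h; rewrite /Defs.addf -(ht _ _ _ oU vB vC q Uq).
    by rewrite /subf addrC subrK.
  rewrite (conn_addr hc oU vA (vD vC vB) (vL vB vC) Up) /Defs.addf; congr (_ + _).
  by rewrite -(ht _ _ _ oU vA (vL vB vC) p Up) /subf addrC subrK.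
have := lie_jacobi f oU vX vY vZ Up.
rewrite /curvature /subf (step X Y Z)// (step Y Z X)// (step Z X Y)//.
lra.
Qed.

Local Notation Rm X Y Z W := (g p (curvature D X Y Z p) (W p)).

Lemma curvature_swap X Y Z W :
  vfield U X -> vfield U Y -> vfield U Z -> vfield U W ->
  Rm X Y Z W = - Rm Y X Z W.
Proof.
move=> vX vY vZ vW; have [hc ht _] := hD.
have t A : vfield U A -> tangent p (A p) by move=> [+ _]; exact.
have vc A B C' (vA : vfield U A) (vB : vfield U B) (vC : vfield U C') :=
  vfield_curvature levi_civita_metric oU vA vB vC.
have E : D (lie X Y) Z p = fun f => - D (lie Y X) Z p f.
  have -> : D (lie X Y) Z p = D (scalef (fun=> -1) (lie Y X)) Z p.
    apply: (conn_local hc oU) => //; first exact: vL.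
      by apply: vfieldZ; [exact: smooth_on_cst | exact: vL].
    move=> q Uq; apply/funext => f.
    rewrite -(ht _ _ _ oU vX vY q Uq) /scalef -(ht _ _ _ oU vY vX q Uq) /subf.
    by rewrite mulN1r opprB.
  rewrite (conn_scalel hc oU _ (vL vY vX) vZ Up); last exact: smooth_on_cst.
  by apply/funext => f; rewrite /scalef mulN1r.
rewrite -[RHS]mulN1r -(metricZl hg)//; [|exact/t/vc|exact: t].
congr (g p _ _); apply/funext => f.
by rewrite /curvature /subf E; ring.
Qed.

Lemma bianchi_metric X Y Z W :
  vfield U X -> vfield U Y -> vfield U Z -> vfield U W ->
  Rm X Y Z W + Rm Y Z X W + Rm Z X Y W = 0.
Proof.
move=> vX vY vZ vW.
have t A : vfield U A -> tangent p (A p) by move=> [+ _]; exact.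
have vc A B C' (vA : vfield U A) (vB : vfield U B) (vC : vfield U C') :=
  t _ (vfield_curvature levi_civita_metric oU vA vB vC).
rewrite -(metricDl hg)//; [|exact: vc|exact: vc|exact: t].
rewrite -(metricDl hg)//; [|by apply: tangent_add; exact: vc|exact: vc|exact: t].
rewrite -[RHS](metric0l hg (t _ vW)); congr (g p _ _).
by apply/funext => f; exact: bianchi.
Qed.

(** The octahedron argument: the four Bianchi identities obtained by rotating the arguments,
    combined with the two skew symmetries, determine the result linearly. *)
Lemma curvature_pair X Y Z W :
  vfield U X -> vfield U Y -> vfield U Z -> vfield U W ->
  Rm X Y Z W = Rm Z W X Y.
Proof.
move=> vX vY vZ vW.
have b1 := bianchi_metric vX vY vZ vW.
have b2 := bianchi_metric vY vZ vW vX.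
have b3 := bianchi_metric vZ vW vX vY.
have b4 := bianchi_metric vW vX vY vZ.
have sk := curvature_skew hg levi_civita_metric oU Up.
have sw := curvature_swap.
have e1 := sk _ _ _ _ vY vZ vX vW; have e2 := sk _ _ _ _ vZ vW vX vY.
have e3 := sk _ _ _ _ vZ vX vW vY; have e4 := sk _ _ _ _ vX vY vZ vW.
have e5 := sk _ _ _ _ vW vX vY vZ; have e6 := sk _ _ _ _ vW vY vX vZ.
have f1 := sw _ _ _ _ vZ vX vY vW.
have f2 := sw _ _ _ _ vW vY vX vZ.
have f3 := sw _ _ _ _ vX vZ vW vY.
have f4 := sw _ _ _ _ vY vW vX vZ.
lra.
Qed.

End LeviCivita.

(** * Curvature of the connection with vectorial torsion *)

Section VectorialTorsion.
Variables (R : realType) (n : nat) (M : manifold R n).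
Variables (g : metric_tensor M) (hg : semi_riemannian g).
Variables (D : field M -> field M -> field M) (hD : levi_civita g D).
Variables (V : field M) (hV : vfield setT V).
Local Notation nabla := (nablaV g D V).
Let hDm := levi_civita_metric hD.

Section Pointwise.
Variables (U : set M) (oU : open U).
Let vD X Y := metric_conn_field hDm (X := X) (Y := Y) oU.
Let vV : vfield U V. Proof. exact: vfield_sub hV. Qed.
Let t A q : U q -> vfield U A -> tangent q (A q).
Proof. by move=> Uq [+ _]; exact. Qed.

Lemma vfield_nablaV X Y : vfield U X -> vfield U Y -> vfield U (nabla X Y).
Proof.
move=> vX vY.
have sg A B (vA : vfield U A) (vB : vfield U B) := metric_smooth hg oU vA vB.
have -> : nabla X Y =
    subf (Defs.addf (D X Y) (scalef (fun q => g q (X q) (Y q)) V))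
         (scalef (fun q => g q (V q) (Y q)) X) by [].
by apply: vfieldB => //; first apply: vfieldD; first exact: vD;
  apply: vfieldZ => //; exact: sg.
Qed.

Lemma metric_nablaV X Y q w : U q -> vfield U X -> vfield U Y -> tangent q w ->
  g q (nabla X Y q) w =
    g q (D X Y q) w + g q (X q) (Y q) * g q (V q) w - g q (V q) (Y q) * g q (X q) w.
Proof.
move=> Uq vX vY tw.
have tD := t Uq (vD vX vY); have tV := t Uq vV; have tX := t Uq vX.
rewrite (metricBl hg (u := fun f => D X Y q f + g q (X q) (Y q) * V q f))//; last 2 first.
- by apply: tangent_add => //; exact: tangent_scale.
- exact: tangent_scale.
by rewrite metricDl ?metricZl//; exact: tangent_scale.
Qed.

(** The torsion correction g(X, Y) g(V, Z) - g(V, Y) g(X, Z) is skew in Y and Z, so it drops out. *)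
Lemma nablaV_metric X Y Z q : U q -> vfield U X -> vfield U Y -> vfield U Z ->
  X q (fun r => g r (Y r) (Z r)) =
    g q (nabla X Y q) (Z q) + g q (Y q) (nabla X Z q).
Proof.
move=> Uq vX vY vZ; have tN := t Uq (vfield_nablaV vX vZ).
rewrite (metric_conn_metric hDm oU vX vY vZ Uq).
rewrite metric_nablaV//; last exact: t.
rewrite [g q (Y q) (nabla _ _ _)]metricC ?metric_nablaV//; [|exact: t..].
rewrite [g q (D X Z q) _]metricC//; [|by apply: t => //; exact: vD|exact: t].
ring.
Qed.

End Pointwise.

Lemma nablaV_metric_connection : metric_connection g nabla.
Proof.
split=> [U X Y oU|U X Y oU|U X Y Z oU vX vY vZ p Up].
- exact: vfield_nablaV.
- exact: metric_conn_lie hDm _ _ _ oU.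
- exact: nablaV_metric vX vY vZ.
Qed.

Variables (U : set M) (oU : open U) (p : M) (Up : U p).
Let vD X Y := metric_conn_field hDm (X := X) (Y := Y) oU.
Let vN X Y := @vfield_nablaV U oU X Y.
Let vL X Y := metric_conn_lie hDm (X := X) (Y := Y) oU.
Let vV : vfield U V. Proof. exact: vfield_sub hV. Qed.
Let t A q : U q -> vfield U A -> tangent q (A q).
Proof. by move=> Uq [+ _]; exact. Qed.
Let mN := nablaV_metric_connection.

Local Notation "<< A , B >>" := (g p (A p) (B p)).
Local Notation P A B := (g p (D A V p) (B p)).

(** The first group of corrections is linear in the derivative of V, the second quadratic in V. *)
Lemma curvatureV_expand X Y Z W :
  vfield U X -> vfield U Y -> vfield U Z -> vfield U W ->
  g p (curvV g D V X Y Z p) (W p) = g p (curvature D X Y Z p) (W p)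
   + (<<Y, Z>> * P X W - P X Z * <<Y, W>> - <<X, Z>> * P Y W + P Y Z * <<X, W>>)
   + (<<Y, Z>> * <<X, V>> * <<V, W>> - <<X, Z>> * <<Y, V>> * <<V, W>>
      - <<V, V>> * (<<Y, Z>> * <<X, W>> - <<X, Z>> * <<Y, W>>)
      + <<V, Z>> * (<<V, Y>> * <<X, W>> - <<V, X>> * <<Y, W>>)).
Proof.
move=> vX vY vZ vW.
have sg A B (vA : vfield U A) (vB : vfield U B) := metric_smooth hg oU vA vB.
have tp A (vA : vfield U A) := t Up vA.
have dotC A B : vfield U A -> vfield U B -> <<A, B>> = <<B, A>>.
  by move=> /tp tA /tp tB; rewrite metricC.
have dN A B : vfield U A -> vfield U B ->
    A p (fun q => g q (nabla B Z q) (W q)) =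
    A p (fun q => g q (D B Z q) (W q))
    + ((<<D A B, Z>> + <<B, D A Z>>) * <<V, W>> + <<B, Z>> * (P A W + <<V, D A W>>))
    - ((P A Z + <<V, D A Z>>) * <<B, W>> + <<V, Z>> * (<<D A B, W>> + <<B, D A W>>)).
  move=> vA vB; have tA := tp _ vA.
  have dm E F vE vF := metric_conn_metric hDm oU vA vE vF Up (Y := E) (Z := F).
  rewrite -!dm//.
  have s1 := sg _ _ (vD vB vZ) vW.
  have s2 := smooth_onM oU (sg _ _ vB vZ) (sg _ _ vV vW).
  have s3 := smooth_onM oU (sg _ _ vV vZ) (sg _ _ vB vW).
  rewrite -(tangentM oU Up tA (sg _ _ vB vZ) (sg _ _ vV vW)).
  rewrite -(tangentM oU Up tA (sg _ _ vV vZ) (sg _ _ vB vW)).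
  rewrite -(tangentD oU Up tA s1 s2) -(tangentB oU Up tA (smooth_onD oU s1 s2) s3).
  apply: (tangent_ext oU Up tA); first exact: sg (vN _ _) _.
  by move=> q Uq; rewrite (metric_nablaV oU Uq vB vZ (t Uq vW)).
have nn A B : vfield U A -> vfield U B -> <<nabla A Z, nabla B W>> =
    <<D A Z, nabla B W>> + <<A, Z>> * <<V, nabla B W>> - <<V, Z>> * <<A, nabla B W>>.
  by move=> vA vB; rewrite (metric_nablaV oU Up vA vZ (tp _ (vN vB vW))).
have nr A B : vfield U A -> vfield U B -> <<A, nabla B W>> =
    <<D B W, A>> + <<B, W>> * <<V, A>> - <<V, W>> * <<B, A>>.
  move=> vA vB; rewrite dotC//; last exact: vN.
  by rewrite (metric_nablaV oU Up vB vW (tp _ vA)).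
(* Writing the bracket as D_X Y - D_Y X lets the terms in D_X Y and D_Y X produced by [dN]
   cancel. *)
have lr A : vfield U A -> <<lie X Y, A>> = <<D X Y, A>> - <<D Y X, A>>.
  move=> vA; rewrite -(metricBl hg)//; [|exact: tp (vD _ _)|exact: tp (vD _ _)|exact: tp].
  by congr (g p _ _); apply/funext => f; rewrite (lc_bracket hD oU Up).
rewrite (curvature_metric hg mN oU Up vX vY vZ vW).
rewrite (curvature_metric hg hDm oU Up vX vY vZ vW).
rewrite (dN X Y)// (dN Y X)// !nn// !nr//; [|exact: vD..].
rewrite (metric_nablaV oU Up (vL vX vY) vZ (tp _ vW)) !lr//.
(* Each inner product is put in one fixed orientation, so that [ring] sees equal atoms. *)
rewrite (dotC (D X W) V) ?(dotC (D Y W) V) ?(dotC (D X W) (D Y Z)) ?(dotC (D Y W) (D X Z))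
  ?(dotC (D X W) Y) ?(dotC (D Y W) X) ?(dotC (D X Z) V) ?(dotC (D X Z) Y)
  ?(dotC (D Y Z) V) ?(dotC (D Y Z) X) ?(dotC Y X) ?(dotC X V) ?(dotC Y V)//; do ?exact: vD.
ring.
Qed.

End VectorialTorsion.

(** * Cyclic sum and frame expansions of the curvature *)

Section Contractions.
Variables (R : realType) (n : nat) (M : manifold R n).
Variables (g : metric_tensor M) (hg : semi_riemannian g).
Variables (D : field M -> field M -> field M) (hD : levi_civita g D).
Variables (V : field M) (hV : vfield setT V).
Let hDm := levi_civita_metric hD.
Variables (U : set M) (oU : open U) (p : M) (Up : U p).
Let vD X Y := metric_conn_field hDm (X := X) (Y := Y) oU.
Let vV : vfield U V. Proof. exact: vfield_sub hV. Qed.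
Let t A : vfield U A -> tangent p (A p).
Proof. by move=> [+ _]; exact. Qed.

Local Notation K X Y Z W := (g p (curvV g D V X Y Z p) (W p)).
Local Notation Rm X Y Z W := (g p (curvature D X Y Z p) (W p)).

Lemma curvatureV_skew X Y Z W :
  vfield U X -> vfield U Y -> vfield U Z -> vfield U W -> K X Y Z W = - K X Y W Z.
Proof. exact: (curvature_skew hg (nablaV_metric_connection hg hD hV) oU Up). Qed.

(* With torsion, pair symmetry fails and the cyclic sum over the last three
   arguments is not zero. *)
Lemma curvatureV_cyclic X Y Z W :
  vfield U X -> vfield U Y -> vfield U Z -> vfield U W ->
  K X Y Z W + K X Z W Y + K X W Y Z = wedge21 g (dflat g D V) X Y Z W p.
Proof.
move=> vX vY vZ vW; rewrite !(curvatureV_expand hg hD hV oU Up)//.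
(* Bianchi cycles the first three slots, the goal the last three. Skewness in [b] and pair symmetry
   in the goal make the Riemannian terms coincide; the terms quadratic in V cancel and those in D V
   pair up into dV. *)
have b := bianchi_metric hg hD oU Up vY vZ vW vX.
have pr := curvature_pair hg hD oU Up.
have sk := curvature_skew hg hDm oU Up.
rewrite (sk Y Z W X)// (sk Z W Y X)// (sk W Y Z X)// in b.
rewrite (pr X Y Z W)// (pr X Z W Y)// (pr X W Y Z)//.
have dotC A B : vfield U A -> vfield U B -> g p (A p) (B p) = g p (B p) (A p).
  by move=> /t tA /t tB; rewrite metricC.
rewrite /wedge21 /dflat (dotC Z Y)// (dotC W Y)// (dotC W Z)//
  (dotC V Y)// (dotC V Z)// (dotC V W)// (dotC V X)//.
lra.
Qed.

(** Both conclusions are proved together, because additivity of D at each step requires the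
    remaining sum to be a vector field. *)
Lemma conn_sum (I : Type) (r : seq I) (h : I -> M -> R) (s : I -> field M) Y :
  (forall i, smooth_on U (h i)) -> (forall i, vfield U (s i)) -> vfield U Y ->
  vfield U (fun q f => \sum_(i <- r) h i q * s i q f) /\
  D (fun q f => \sum_(i <- r) h i q * s i q f) Y p =
    (fun f => \sum_(i <- r) h i p * D (s i) Y p f).
Proof.
move=> sh vs vY; have hc := lc_connection hD.
elim: r => [|i r [vS DS]].
  have -> : (fun q f => \sum_(i <- [::]) h i q * s i q f) = (fun _ _ => 0).
    by apply/funext => q; apply/funext => f; rewrite big_nil.
  split; first exact: vfield0.
  have -> : (fun f => \sum_(i <- [::]) h i p * D (s i) Y p f) = (fun=> 0).
    by apply/funext => f; rewrite big_nil.
  (* For the empty sum, D 0 Y = 0 follows from scaling by the zero function. *)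
  have := conn_scalel hc oU (smooth_on_cst 0 oU) (vfield0 U) vY Up.
  have -> : scalef (fun=> 0) (fun _ _ => 0) = (fun _ _ => 0) :> field M.
    by apply/funext => q; apply/funext => f; rewrite /scalef mul0r.
  by move=> ->; apply/funext => f; rewrite /scalef mul0r.
set S := (fun q f => \sum_(j <- r) h j q * s j q f) in vS DS.
have -> : (fun q f => \sum_(j <- i :: r) h j q * s j q f) =
    Defs.addf (scalef (h i) (s i)) S.
  by apply/funext => q; apply/funext => f; rewrite big_cons.
have vi : vfield U (scalef (h i) (s i)) by exact: vfieldZ.
split; first exact: vfieldD.
rewrite (conn_addl hc oU vi vS vY Up) /Defs.addf DS.
rewrite (conn_scalel hc oU (sh i) (vs i) vY Up).
by apply/funext => f; rewrite big_cons.
Qed.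

Variables (eps : 'I_n -> R) (s : 'I_n -> field M).
Hypothesis hs : orthonormal_frame g eps U s.
Let vs i := frame_vfield hs i.

Local Notation coef Y i := (eps i * g p (Y p) (s i p)).

Lemma metric_frame_sum Y w : vfield U Y -> tangent p w ->
  g p (Y p) w = \sum_i coef Y i * g p (s i p) w.
Proof.
move=> vY tw; rewrite {1}(frame_expand hg hs Up (t vY)) (metric_suml hg)//.
by move=> i; exact: t.
Qed.

(** [D] takes a field as first argument, so the expansion of Y must hold on all of U, with smooth
    coefficients, before locality applies. *)
Lemma conn_frame_sum Y Z w : vfield U Y -> vfield U Z -> tangent p w ->
  g p (D Y Z p) w = \sum_i coef Y i * g p (D (s i) Z p) w.
Proof.
move=> vY vZ tw; pose h i q := eps i * g q (Y q) (s i q).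
have sh i : smooth_on U (h i).
  apply: smooth_onM => //; first exact: smooth_on_cst.
  exact: metric_smooth.
have [vS DS] := conn_sum (index_enum _) sh vs vZ.
have -> : D Y Z p = D (fun q f => \sum_i h i q * s i q f) Z p.
  apply: (conn_local (lc_connection hD) oU) => // q Uq.
  by apply: (frame_expand hg hs Uq); case: vY => + _; exact.
rewrite DS (metric_suml hg)// => i; exact: t (vD _ _).
Qed.

(** Pair symmetry turns the Riemannian part into g(Y, R(Z, W)X), linear in Y at p. The remaining
    terms see Y only through g(Y, -) and g(D_Y V, -). [KE] displays this shape. *)
Lemma curvatureV_frame_sum2 X Y Z W :
  vfield U X -> vfield U Y -> vfield U Z -> vfield U W ->
  K X Y Z W = \sum_i coef Y i * K X (s i) Z W.
Proof.
move=> vX vY vZ vW.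
have dotC A B : vfield U A -> vfield U B -> g p (A p) (B p) = g p (B p) (A p).
  by move=> /t tA /t tB; rewrite metricC.
have tR : tangent p (curvature D Z W X p).
  by apply: t; exact: (vfield_curvature hDm).
have RmE A : vfield U A -> Rm X A Z W = g p (A p) (curvature D Z W X p).
  by move=> vA; rewrite (curvature_pair hg hD oU Up)// metricC//; exact: t.
have KE A : vfield U A -> K X A Z W =
    g p (A p) (curvature D Z W X p)
    + g p (D A V p) (W p) * - g p (X p) (Z p)
    + g p (D A V p) (Z p) * g p (X p) (W p)
    + g p (A p) (Z p) * (g p (D X V p) (W p) + g p (X p) (V p) * g p (V p) (W p)
                         - g p (V p) (V p) * g p (X p) (W p))
    + g p (A p) (W p) * (- g p (D X V p) (Z p) + g p (V p) (V p) * g p (X p) (Z p)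
                         - g p (V p) (Z p) * g p (V p) (X p))
    + g p (A p) (V p) * (- g p (X p) (Z p) * g p (V p) (W p)
                         + g p (V p) (Z p) * g p (X p) (W p)).
  move=> vA; rewrite (curvatureV_expand hg hD hV oU Up)// RmE// (dotC V A)//; ring.
rewrite KE//; under eq_bigr do rewrite KE//.
rewrite !(conn_frame_sum vY)//; [|exact: t..].
rewrite !(metric_frame_sum vY)//; [|exact: t..].
rewrite !mulr_suml -!big_split; apply: eq_bigr => i _ /=; ring.
Qed.

(** Skewness moves Z to the last slot, where it enters through its value at p alone. *)
Lemma curvatureV_frame_sum3 X Y Z W :
  vfield U X -> vfield U Y -> vfield U Z -> vfield U W ->
  K X Y Z W = \sum_i coef Z i * K X Y (s i) W.
Proof.
move=> vX vY vZ vW.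
have vK A B C' vA vB vC := vfield_curvature (nablaV_metric_connection hg hD hV) oU
  (X := A) (Y := B) (Z := C') vA vB vC.
have tK : tangent p (curvV g D V X Y W p) by apply: t; exact: vK.
rewrite curvatureV_skew// metricC//; last exact: t.
rewrite (metric_frame_sum vZ tK) -sumrN; apply: eq_bigr => i _.
by rewrite (curvatureV_skew vX vY (vs i) vW) mulrN [in RHS](metricC hg tK (t (vs i))).
Qed.

End Contractions.

(** * Quadratic and cubic elements of the Clifford algebra *)

(** Trades sums over i < j for full double sums, whose indices can be exchanged freely. The Clifford
    identities below are proved doubled for this reason and then divided by 2. *)
Lemma sum_lt_sym (V : zmodType) (n : nat) (G : 'I_n -> 'I_n -> V) :
  (forall i j, G i j = G j i) -> (forall i, G i i = 0) ->
  \sum_i \sum_j G i j = (\sum_(i < n) \sum_(j < n | (i < j)%N) G i j) *+ 2.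
Proof.
move=> Gs G0.
have -> : \sum_i \sum_j G i j = \sum_(i < n) \sum_(j < n)
    ((if (i < j)%N then G i j else 0) + (if (j < i)%N then G i j else 0)).
  apply: eq_bigr => i _; apply: eq_bigr => j _.
  by case: (ltngtP i j) => [||/val_inj->]; rewrite ?addr0 ?add0r.
under eq_bigr do rewrite big_split /=.
rewrite big_split /= [X in _ + X]exchange_big /= mulr2n.
congr (_ + _); apply: eq_bigr => i _; rewrite [RHS]big_mkcond //.
by apply: eq_bigr => j _; rewrite Gs.
Qed.

Section CliffordAlgebra.
Variables (F : numFieldType) (m n : nat) (eps : 'I_n -> F) (gam : 'I_n -> 'M[F]_m).
Hypothesis gamP : forall i j, gam i *m gam j + gam j *m gam i
  = (- (eps i *+ (i == j)) *+ 2)%:M.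

Definition cl_quad (w : 'I_n -> 'I_n -> F) : 'M[F]_m :=
  \sum_(i < n) \sum_(j < n | (i < j)%N) w i j *: (gam i *m gam j).

Definition cl_cubic (c : 'I_n -> 'I_n -> 'I_n -> F) : 'M[F]_m :=
  \sum_(i < n) \sum_(j < n | (i < j)%N) \sum_(k < n | (j < k)%N)
    c i j k *: (gam i *m gam j *m gam k).

Definition skew_form (w : 'I_n -> 'I_n -> F) : Prop := forall i j, w i j = - w j i.

Lemma cl_quadD u w : cl_quad (fun i j => u i j + w i j) = cl_quad u + cl_quad w.
Proof.
rewrite -big_split; apply: eq_bigr => i _; rewrite -big_split.
by apply: eq_bigr => j _; rewrite scalerDl.
Qed.

Lemma cl_quadZ c w : cl_quad (fun i j => c * w i j) = c *: cl_quad w.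
Proof.
rewrite scaler_sumr; apply: eq_bigr => i _; rewrite scaler_sumr.
by apply: eq_bigr => j _; rewrite scalerA.
Qed.

Lemma cl_quad_sum (I : Type) (r : seq I) (c : I -> F) (w : I -> 'I_n -> 'I_n -> F) :
  cl_quad (fun i j => \sum_(k <- r) c k * w k i j) = \sum_(k <- r) c k *: cl_quad (w k).
Proof.
elim: r => [|k r IH].
  rewrite big_nil; apply: big1 => i _; apply: big1 => j _.
  by rewrite big_nil scale0r.
rewrite big_cons -IH -cl_quadZ -cl_quadD; do 2!apply: eq_bigr => ? _.
by rewrite big_cons.
Qed.

Lemma eq_cl_quad u w : (forall i j, u i j = w i j) -> cl_quad u = cl_quad w.
Proof. by move=> uw; do 2!apply: eq_bigr => ? _; rewrite uw. Qed.

Lemma cl_quadB u w : cl_quad (fun i j => u i j - w i j) = cl_quad u - cl_quad w.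
Proof.
rewrite -scaleN1r -cl_quadZ -cl_quadD.
by apply: eq_cl_quad => i j; rewrite mulN1r.
Qed.

Lemma skew_diag w : skew_form w -> forall i, w i i = 0.
Proof. by move=> sw i; apply/eqP; rewrite -eqNr -sw. Qed.

Lemma gam_swap i j :
  gam i *m gam j = - (gam j *m gam i) - (eps i *+ (i == j) *+ 2)%:M.
Proof. by apply/eqP; rewrite -subr_eq0 opprD !opprK addrA gamP -raddfD /= mulNrn addNr raddf0. Qed.

Lemma gam_anti i j : i != j -> gam i *m gam j = - (gam j *m gam i).
Proof. by move=> /negbTE ij; rewrite gam_swap ij !mul0rn raddf0 subr0. Qed.

Lemma gam_sqr i : gam i *m gam i = (- eps i)%:M.
Proof.
have := gamP i i; rewrite eqxx mulr1n -mulr2n raddfMn /= => E.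
by apply/matrixP => a b; move/matrixP/(_ a b)/eqP: E; rewrite !mulmxnE eqrMn2r// => /eqP.
Qed.

Lemma cl_quad_full w : skew_form w ->
  cl_quad w *+ 2 = \sum_i \sum_j w i j *: (gam i *m gam j).
Proof.
move=> sw; rewrite sum_lt_sym// => [i j|i]; last by rewrite skew_diag// scale0r.
have [->//|/gam_anti ->] := eqVneq i j.
by rewrite scalerN [in RHS]sw scaleNr.
Qed.

(** The action of the Lie algebra of Spin on vectors: by commutator, a quadratic element acts as an
    infinitesimal rotation. Moving [gam k] across [gam i *m gam j] takes two swaps, whose scalar
    parts survive only for j = k and i = k. *)
Lemma cl_quad_vec w k : skew_form w ->
  cl_quad w *m gam k - gam k *m cl_quad w = \sum_j (w k j * eps k *+ 2) *: gam j.
Proof.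
move=> sw.
have e1 i j : gam i *m gam j *m gam k =
    - (gam i *m gam k *m gam j) - (eps j *+ (j == k) *+ 2) *: gam i.
  by rewrite -mulmxA (gam_swap j k) mulmxBr mulmxN mul_mx_scalar mulmxA.
have e2 i j : gam i *m gam k *m gam j =
    - (gam k *m gam i *m gam j) - (eps i *+ (i == k) *+ 2) *: gam j.
  by rewrite (gam_swap i k) mulmxBl mulNmx mul_scalar_mx.
have cg i j : gam i *m gam j *m gam k - gam k *m (gam i *m gam j) =
    (eps i *+ (i == k) *+ 2) *: gam j - (eps j *+ (j == k) *+ 2) *: gam i.
  by rewrite e1 e2 mulmxA opprB opprK addrAC addrK.
have two_unit : (2 : F) != 0 by rewrite pnatr_eq0.
apply: (scalerI two_unit); rewrite scalerBr scalemxAl scalemxAr !scaler_nat.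
rewrite cl_quad_full// mulmx_suml mulmx_sumr -sumrB.
have pick (G : 'I_n -> 'I_n -> F) (v : 'I_n -> 'M[F]_m) :
    \sum_i \sum_j (G i j *+ (i == k)) *: v j = \sum_j G k j *: v j.
  rewrite (bigD1 k)//= [X in _ + X]big1 ?addr0.
    by under eq_bigr do rewrite eqxx mulr1n.
  by move=> i ik; apply: big1 => j _; rewrite (negbTE ik) mulr0n scale0r.
transitivity (\sum_i \sum_j ((w i j * eps i *+ 2) *+ (i == k)) *: gam j
   - \sum_i \sum_j ((w j i * eps i *+ 2) *+ (i == k)) *: gam j).
  rewrite [X in _ - X]exchange_big -sumrB; apply: eq_bigr => i _.
  rewrite mulmx_suml mulmx_sumr -!sumrB; apply: eq_bigr => j _.
  rewrite -scalemxAl -scalemxAr -scalerBr cg scalerBr !scalerA.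
  by rewrite !mulrnAr [_ *+ _ *+ 2]mulrnAC [w i j * eps j *+ _ *+ 2]mulrnAC.
rewrite !pick -sumrB -sumrMnl; apply: eq_bigr => i _.
by rewrite [w i k]sw mulNr mulNrn scaleNr opprK [RHS]mulr2n.
Qed.

(** The commutator with [cl_quad a] is a derivation, so its effect on a product of two generators
    follows from [cl_quad_vec]. The result is again quadratic: it is the bracket of two skew
    matrices. *)
Lemma cl_quad_comm a b : skew_form a -> skew_form b ->
  cl_quad a *m cl_quad b - cl_quad b *m cl_quad a =
  cl_quad (fun i j => (\sum_k eps k * (a k i * b k j - a k j * b k i)) *+ 2).
Proof.
move=> sa sb; pose A := cl_quad a.
have cg k l : A *m (gam k *m gam l) - gam k *m gam l *m A =
    \sum_j (a k j * eps k *+ 2) *: (gam j *m gam l)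
    + \sum_j (a l j * eps l *+ 2) *: (gam k *m gam j).
  have -> : A *m (gam k *m gam l) - gam k *m gam l *m A =
     (A *m gam k - gam k *m A) *m gam l + gam k *m (A *m gam l - gam l *m A).
    by rewrite mulmxBl mulmxBr !mulmxA addrA subrK.
  rewrite !cl_quad_vec// mulmx_suml mulmx_sumr; congr (_ + _); apply: eq_bigr => j _.
    by rewrite scalemxAl.
  by rewrite scalemxAr.
have two_unit : (2 : F) != 0 by rewrite pnatr_eq0.
apply: (scalerI two_unit).
rewrite scalerBr scalemxAr [X in _ - X]scalemxAl !scaler_nat cl_quad_full//.
rewrite [RHS]cl_quad_full; last first.
  by move=> i j; rewrite -mulNrn -sumrN; congr (_ *+ 2); apply: eq_bigr => k _; ring.
rewrite -/A; clearbody A; rewrite mulmx_suml mulmx_sumr -sumrB.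
have -> : \sum_i (A *m (\sum_j b i j *: (gam i *m gam j)) -
                  (\sum_j b i j *: (gam i *m gam j)) *m A) =
   \sum_i \sum_l \sum_j ((b i l * (a i j * eps i *+ 2)) *: (gam j *m gam l)
                   + (b i l * (a l j * eps l *+ 2)) *: (gam i *m gam j)).
  apply: eq_bigr => i _; rewrite mulmx_suml mulmx_sumr -sumrB; apply: eq_bigr => l _.
  rewrite -scalemxAl -scalemxAr -scalerBr cg scalerDr !scaler_sumr -big_split /=.
  by apply: eq_bigr => j _; rewrite !scalerA.
have -> : \sum_i \sum_l \sum_j ((b i l * (a i j * eps i *+ 2)) *: (gam j *m gam l)
                   + (b i l * (a l j * eps l *+ 2)) *: (gam i *m gam j)) =
  \sum_i \sum_l \sum_j (b i l * (a i j * eps i *+ 2)) *: (gam j *m gam l)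
  + \sum_i \sum_l \sum_j (b i l * (a l j * eps l *+ 2)) *: (gam i *m gam j).
  rewrite -big_split; apply: eq_bigr => i _; rewrite -big_split; apply: eq_bigr => l _.
  by rewrite -big_split.
(* The two triple sums are reordered to make the contracted index innermost: the first index in one,
   the second in the other. *)
under eq_bigr do rewrite exchange_big /=.
rewrite exchange_big /=; under eq_bigr do rewrite exchange_big /=.
under [X in _ + X]eq_bigr do rewrite exchange_big /=.
rewrite -big_split; apply: eq_bigr => i _; rewrite -big_split; apply: eq_bigr => j _ /=.
rewrite -!scaler_suml -scalerDl; congr (_ *: _).
rewrite -big_split -sumrMnl; apply: eq_bigr => k _ /=.
rewrite (sb i k); ring.
Qed.

Lemma cl_cubicE c : cl_cubic c = \sum_(i < n) \sum_(j < n) \sum_(k < n)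
  (if (i < j < k)%N then c i j k *: (gam i *m gam j *m gam k) else 0).
Proof.
apply: eq_bigr => i _; rewrite big_mkcond; apply: eq_bigr => j _.
case: ifP => ij; last by rewrite big1.
by rewrite big_mkcond; apply: eq_bigr.
Qed.

(* Each product e_k . e_i . e_j with i < j is sorted according to the position
   of k; the cases k = i and k = j give the trace. *)
Lemma cl_quad_contract (t : 'I_n -> 'I_n -> 'I_n -> F) : (forall k, skew_form (t k)) ->
  \sum_k gam k *m cl_quad (t k) =
    - (\sum_k \sum_j (eps k * t k k j) *: gam j)
    + cl_cubic (fun i j k => t i j k + t j k i + t k i j).
Proof.
move=> st.
(* [S] is a summand of the cubic part, nonzero only for increasing indices; [P] is the trace
   contribution when k meets i or j. *)
pose S (i j k : 'I_n) (c : F) := if (i < j < k)%N then c *: (gam i *m gam j *m gam k) else 0.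
pose P (k j : 'I_n) := - ((eps k * t k k j) *: gam j).
have split_term (k i j : 'I_n) :
    (if (i < j)%N then t k i j *: (gam k *m (gam i *m gam j)) else 0) =
    S k i j (t k i j) + S i k j (t k j i) + S i j k (t k i j)
    + ((if i == k then (if (k < j)%N then P k j else 0) else 0)
       + (if j == k then (if (i < k)%N then P k i else 0) else 0)).
  rewrite /S /P mulmxA.
  have [<-|ik] := eqVneq i k.
    rewrite !ltnn (_ : (i < j < i)%N = false) /= ?add0r; last by lia.
    have [<-|ij] := eqVneq j i; first by rewrite ltnn !addr0.
    case: ltnP => _; rewrite !addr0//.
    by rewrite gam_sqr mul_scalar_mx scalerA mulrN mulrC scaleNr.
  have [<-|jk] := eqVneq j k.
    rewrite !ltnn andbF (_ : (j < i < j)%N = false) /= ?add0r; last by lia.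
    case: ltnP => ij; last by [].
    have ji : j != i by apply/eqP => ji; rewrite ji ltnn in ij.
    rewrite (gam_anti ji) mulNmx -mulmxA gam_sqr mul_mx_scalar.
    by rewrite scaleNr opprK scalerA [t j i j]st mulNr scaleNr mulrC.
  have /eqP nik : (i != k :> nat) by []; have /eqP njk : (j != k :> nat) by [].
  have ki' : k != i by rewrite eq_sym.
  have kj' : k != j by rewrite eq_sym.
  (* With distinct indices and i < j, k needs zero, one or two swaps to reach its place. The sign of
     a single swap is absorbed by the skewness of [t k]. *)
  case: (ltngtP i j) => ij; case: (ltngtP k i) => ki; case: (ltngtP k j) => kj;
    rewrite /= ?addr0 ?add0r //; try lia.
  - by rewrite (gam_anti ki') mulNmx scalerN [t k i j]st scaleNr opprK.
  - by rewrite (gam_anti ki') mulNmx -(mulmxA _ (gam k)) (gam_anti kj') mulmxN opprK mulmxA.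
rewrite cl_cubicE.
have -> : \sum_k gam k *m cl_quad (t k) = \sum_(k < n) \sum_(i < n) \sum_(j < n)
   (if (i < j)%N then t k i j *: (gam k *m (gam i *m gam j)) else 0).
  apply: eq_bigr => k _; rewrite mulmx_sumr; apply: eq_bigr => i _.
  rewrite mulmx_sumr big_mkcond; apply: eq_bigr => j _.
  by case: ifP => // _; rewrite -scalemxAr.
have sum3D (G H : 'I_n -> 'I_n -> 'I_n -> 'M[F]_m) :
    \sum_i \sum_j \sum_k (G i j k + H i j k) =
    \sum_i \sum_j \sum_k G i j k + \sum_i \sum_j \sum_k H i j k.
  rewrite -big_split; apply: eq_bigr => i _; rewrite -big_split.
  by apply: eq_bigr => j _; rewrite -big_split.
under eq_bigr do under eq_bigr do under eq_bigr do rewrite split_term.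
rewrite !sum3D addrC; congr (_ + _).
  have -> : \sum_(k < n) \sum_(i < n) \sum_(j < n)
      (if i == k then (if (k < j)%N then P k j else 0) else 0) =
      \sum_(k < n) \sum_(j < n) (if (k < j)%N then P k j else 0).
    apply: eq_bigr => k _; rewrite exchange_big; apply: eq_bigr => j _.
    by rewrite -big_mkcond big_pred1_eq.
  have -> : \sum_(k < n) \sum_(i < n) \sum_(j < n)
      (if j == k then (if (i < k)%N then P k i else 0) else 0) =
      \sum_(k < n) \sum_(i < n) (if (i < k)%N then P k i else 0).
    apply: eq_bigr => k _; apply: eq_bigr => j _.
    by rewrite -big_mkcond big_pred1_eq.
  (* The ranges k < j and j < k cover all pairs off the diagonal, where [t k k k] is 0. *)
  rewrite -big_split -sumrN; apply: eq_bigr => k _.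
  rewrite -big_split -sumrN; apply: eq_bigr => j _ /=.
  case: (ltngtP k j) => [_|_|/val_inj <-]; rewrite ?addr0 ?add0r//.
  by rewrite (skew_diag (st k)) mulr0 scale0r oppr0.
rewrite [X in _ + X + _]exchange_big /=.
have -> : \sum_k \sum_i \sum_j S i j k (t k i j) = \sum_i \sum_j \sum_k S i j k (t k i j).
  by rewrite exchange_big; apply: eq_bigr => i _; rewrite exchange_big.
rewrite -!sum3D; apply: eq_bigr => i _; apply: eq_bigr => j _; apply: eq_bigr => k _.
by rewrite /S; case: ifP => _; rewrite ?addr0// !scalerDl.
Qed.

End CliffordAlgebra.

(** * Derivatives of complex and matrix-valued functions *)

Section ComplexCalculus.
Variables (R : realType) (n : nat) (M : manifold R n).
Local Notation C := (R[i]).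
Local Notation realC := (real_complex R).
Implicit Types (W : set M) (f h : M -> C).

Lemma Re_add (x y : C) : complex.Re (x + y) = complex.Re x + complex.Re y.
Proof. by case: x => a b; case: y. Qed.
Lemma Im_add (x y : C) : complex.Im (x + y) = complex.Im x + complex.Im y.
Proof. by case: x => a b; case: y. Qed.
Lemma Re_mul (x y : C) : complex.Re (x * y) =
  complex.Re x * complex.Re y - complex.Im x * complex.Im y.
Proof. by case: x => a b; case: y. Qed.
Lemma Im_mul (x y : C) : complex.Im (x * y) =
  complex.Re x * complex.Im y + complex.Im x * complex.Re y.
Proof. by case: x => a b; case: y. Qed.

Lemma csmooth_on_sub W W' f : W' `<=` W -> csmooth_on W f -> csmooth_on W' f.
Proof. by move=> sW [s1 s2]; split; apply: smooth_on_sub sW _. Qed.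

Lemma csmooth_on_cst W (c : C) : open W -> csmooth_on W (fun=> c).
Proof. by move=> oW; split; exact: smooth_on_cst. Qed.

Lemma csmooth_on_real W (f : M -> R) : open W -> smooth_on W f ->
  csmooth_on W (fun q => realC (f q)).
Proof. by move=> oW sf; split => //; exact: smooth_on_cst. Qed.

Lemma csmooth_onD W f h : open W -> csmooth_on W f -> csmooth_on W h ->
  csmooth_on W (fun q => f q + h q).
Proof.
move=> oW [f1 f2] [h1 h2]; split.
  by under eq_fun do rewrite Re_add; exact: smooth_onD.
by under eq_fun do rewrite Im_add; exact: smooth_onD.
Qed.

Lemma csmooth_onM W f h : open W -> csmooth_on W f -> csmooth_on W h ->
  csmooth_on W (fun q => f q * h q).
Proof.
move=> oW [f1 f2] [h1 h2]; split.
  by under eq_fun do rewrite Re_mul; apply: smooth_onB => //; exact: smooth_onM.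
by under eq_fun do rewrite Im_mul; apply: smooth_onD => //; exact: smooth_onM.
Qed.

Lemma csmooth_on_sum W (I : Type) (r : seq I) (P : pred I) (f : I -> M -> C) :
  open W -> (forall i, csmooth_on W (f i)) ->
  csmooth_on W (fun q => \sum_(i <- r | P i) f i q).
Proof.
move=> oW sf; elim: r => [|i r IH].
  by under eq_fun do rewrite big_nil; exact: csmooth_on_cst.
under eq_fun do rewrite big_cons; case: (P i) => //.
exact: csmooth_onD.
Qed.

Definition cderiv (v : functional M) f : C :=
  ((v (fun q => complex.Re (f q))) +i* (v (fun q => complex.Im (f q))))%C.

Definition mxsmooth_on W a b (A : M -> 'M[C]_(a, b)) : Prop :=
  forall i j, csmooth_on W (fun q => A q i j).

(** On columns this is [dspin]; general shapes are needed to differentiate the connection form as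
    well. *)
Definition mxderiv (v : functional M) a b (A : M -> 'M[C]_(a, b)) : 'M[C]_(a, b) :=
  \matrix_(i, j) cderiv v (fun q => A q i j).

Lemma mxsmooth_onD W a b (A B : M -> 'M[C]_(a, b)) : open W ->
  mxsmooth_on W A -> mxsmooth_on W B -> mxsmooth_on W (fun q => A q + B q).
Proof.
by move=> oW sA sB i j; under eq_fun do rewrite mxE; exact: csmooth_onD.
Qed.

Lemma mxsmooth_onM W a b c (A : M -> 'M[C]_(a, b)) (B : M -> 'M[C]_(b, c)) : open W ->
  mxsmooth_on W A -> mxsmooth_on W B -> mxsmooth_on W (fun q => A q *m B q).
Proof.
move=> oW sA sB i j; under eq_fun do rewrite mxE.
by apply: csmooth_on_sum => // k; exact: csmooth_onM.
Qed.

Section Derivation.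
Variables (W : set M) (p : M) (v : functional M).
Hypotheses (oW : open W) (Wp : W p) (tv : tangent p v).

Lemma cderiv_ext f h : csmooth_on W f -> (forall q, W q -> f q = h q) ->
  cderiv v f = cderiv v h.
Proof.
move=> [f1 f2] fh; rewrite /cderiv; congr (_ +i* _)%C.
  by apply: (tangent_ext oW Wp tv f1) => q Wq; rewrite fh.
by apply: (tangent_ext oW Wp tv f2) => q Wq; rewrite fh.
Qed.

Lemma cderiv_cst (c : C) : cderiv v (fun=> c) = 0.
Proof. by rewrite /cderiv !(tangent_cst oW Wp tv). Qed.

Lemma cderiv_real (f : M -> R) : cderiv v (fun q => realC (f q)) = realC (v f).
Proof. by rewrite /cderiv /= (tangent_cst oW Wp tv). Qed.

Lemma cderivD f h : csmooth_on W f -> csmooth_on W h ->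
  cderiv v (fun q => f q + h q) = cderiv v f + cderiv v h.
Proof.
move=> [f1 f2] [h1 h2]; rewrite /cderiv.
under eq_fun do rewrite Re_add; under [in X in (_ +i* X)%C]eq_fun do rewrite Im_add.
by rewrite !(tangentD oW Wp tv).
Qed.

Lemma cderivM f h : csmooth_on W f -> csmooth_on W h ->
  cderiv v (fun q => f q * h q) = cderiv v f * h p + f p * cderiv v h.
Proof.
move=> [f1 f2] [h1 h2]; rewrite /cderiv.
under eq_fun do rewrite Re_mul; under [in X in (_ +i* X)%C]eq_fun do rewrite Im_mul.
rewrite (tangentB oW Wp tv) ?(tangentD oW Wp tv) ?(tangentM oW Wp tv)//; do ?exact: smooth_onM.
case: (f p) => a b; case: (h p) => c d.
by apply/eqP; rewrite eq_complex /=; apply/andP; split; apply/eqP; ring.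
Qed.

Lemma cderiv_sum (I : Type) (r : seq I) (P : pred I) (f : I -> M -> C) :
  (forall i, csmooth_on W (f i)) ->
  cderiv v (fun q => \sum_(i <- r | P i) f i q) = \sum_(i <- r | P i) cderiv v (f i).
Proof.
move=> sf; elim: r => [|i r IH].
  by under eq_fun do rewrite big_nil; rewrite big_nil cderiv_cst.
under eq_fun do rewrite big_cons; rewrite big_cons -IH.
by case: (P i) => //; rewrite cderivD//; exact: csmooth_on_sum.
Qed.

Lemma mxderiv_ext a b (A B : M -> 'M[C]_(a, b)) : mxsmooth_on W A ->
  (forall q, W q -> A q = B q) -> mxderiv v A = mxderiv v B.
Proof.
move=> sA AB; apply/matrixP => i j; rewrite !mxE; apply: cderiv_ext => // q Wq.
by rewrite AB.
Qed.

Lemma mxderivD a b (A B : M -> 'M[C]_(a, b)) : mxsmooth_on W A -> mxsmooth_on W B ->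
  mxderiv v (fun q => A q + B q) = mxderiv v A + mxderiv v B.
Proof.
move=> sA sB; apply/matrixP => i j; rewrite !mxE -cderivD//.
by congr (cderiv v _); apply/funext => q; rewrite mxE.
Qed.

Lemma mxderivM a b c (A : M -> 'M[C]_(a, b)) (B : M -> 'M[C]_(b, c)) :
  mxsmooth_on W A -> mxsmooth_on W B ->
  mxderiv v (fun q => A q *m B q) = mxderiv v A *m B p + A p *m mxderiv v B.
Proof.
move=> sA sB; apply/matrixP => i j; rewrite !mxE.
under eq_fun do rewrite mxE; rewrite cderiv_sum => [|k]; last exact: csmooth_onM.
rewrite -big_split; apply: eq_bigr => k _ /=.
by rewrite cderivM// !mxE.
Qed.

End Derivation.

Section QuadraticField.
Variables (m : nat) (gam : 'I_n -> 'M[C]_m) (W : set M) (w : 'I_n -> 'I_n -> M -> R).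
Hypotheses (oW : open W) (sw : forall i j, smooth_on W (w i j)).
Local Notation A := (fun q => cl_quad gam (fun i j => realC (w i j q))).

Let AE q a b : A q a b = \sum_(i < n) \sum_(j < n | (i < j)%N)
  realC (w i j q) * (gam i *m gam j) a b.
Proof.
rewrite summxE; apply: eq_bigr => i _; rewrite summxE; apply: eq_bigr => j _.
by rewrite mxE.
Qed.

Lemma mxsmooth_cl_quad : mxsmooth_on W A.
Proof.
move=> a b; under eq_fun do rewrite AE.
apply: csmooth_on_sum => // i; apply: csmooth_on_sum => // j.
apply: csmooth_onM => //; first exact: csmooth_on_real.
exact: csmooth_on_cst.
Qed.

Lemma mxderiv_cl_quad p v : W p -> tangent p v ->
  mxderiv v A = cl_quad gam (fun i j => realC (v (w i j))).
Proof.
move=> Wp tv; apply/matrixP => a b; rewrite mxE.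
under eq_fun do rewrite AE; rewrite summxE.
have s2 i j : csmooth_on W (fun q => realC (w i j q) * (gam i *m gam j) a b).
  by apply: csmooth_onM => //; [exact: csmooth_on_real | exact: csmooth_on_cst].
rewrite (cderiv_sum oW Wp tv) => [|i]; last exact: csmooth_on_sum.
apply: eq_bigr => i _; rewrite (cderiv_sum oW Wp tv)// summxE.
apply: eq_bigr => j _; rewrite (cderivM oW Wp tv); last 2 first.
- exact: csmooth_on_real.
- exact: csmooth_on_cst.
by rewrite (cderiv_cst oW Wp tv) mulr0 addr0 (cderiv_real oW Wp tv) [RHS]mxE.
Qed.

End QuadraticField.

End ComplexCalculus.

(** * Curvature of the spin connection *)

(** A trace does not depend on the orthonormal frame: c is the change of frame, and the hypothesis
    is its Gram relation between the signs d and d'. Values lie in a module, since both the scalar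
    Ricci trace and the spinor-valued contraction are transported. *)
Lemma frame_contract (F : comNzRingType) (L : lmodType F) (n : nat)
    (d d' : 'I_n -> F) (c : 'I_n -> 'I_n -> F) (K : 'I_n -> 'I_n -> L) :
  (forall j m, \sum_k d k * (c k j * c k m) = d' j *+ (j == m)) ->
  \sum_k d k *: (\sum_j \sum_m (c k j * c k m) *: K j m) = \sum_j d' j *: K j j.
Proof.
move=> gram.
have -> : \sum_k d k *: (\sum_j \sum_m (c k j * c k m) *: K j m) =
    \sum_j \sum_m \sum_k (d k * (c k j * c k m)) *: K j m.
  rewrite [RHS](eq_bigr _ (fun j _ => exchange_big _ _ _ _ _ _)) /= [RHS]exchange_big.
  apply: eq_bigr => k _; rewrite scaler_sumr; apply: eq_bigr => j _.
  by rewrite scaler_sumr; apply: eq_bigr => m _; rewrite scalerA.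
apply: eq_bigr => j _; rewrite (bigD1 j)//= -scaler_suml gram eqxx mulr1n.
rewrite big1 ?addr0// => m mj.
by rewrite -scaler_suml gram eq_sym (negbTE mj) mulr0n scale0r.
Qed.

Section SpinConnection.
Variables (R : realType) (n : nat) (M : manifold R n).
Variables (g : metric_tensor M) (hg : semi_riemannian g) (T : spin_structure g).
Variables (D : field M -> field M -> field M) (hD : levi_civita g D).
Variables (V : field M) (hV : vfield setT V).
Variables (psi : sections T) (hpsi : spinor_field psi).
Variables (a : six T) (W : set M) (oW : open W) (Wa : W `<=` sdom a).
Local Notation C := (R[i]).
Local Notation realC := (real_complex R).
Local Notation s := (sframe a).
Local Notation eps := (seps T).
Local Notation gam := (sgam T).
Local Notation nabla := (nablaV g D V).

Lemma frame_restrict (d : 'I_n -> R) (U U' : set M) e : U' `<=` U ->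
  orthonormal_frame g d U e -> orthonormal_frame g d U' e.
Proof.
move=> sU [d1 ve oe ex]; split=> // [i|p /sU Up|p /sU Up].
- exact: vfield_sub (ve i).
- exact: oe.
- exact: ex.
Qed.

Let hs : orthonormal_frame g eps W s.
Proof. exact: frame_restrict Wa (sframeP a). Qed.
Let vs i : vfield W (s i). Proof. exact: (frame_vfield hs). Qed.
Let vN X Y := @vfield_nablaV R n M g hg D hD V hV W oW X Y.
Let mN := nablaV_metric_connection hg hD hV.
Let t A q : W q -> vfield W A -> tangent q (A q).
Proof. by move=> Wq [+ _]; exact. Qed.

Lemma gam_clifford i j : gam i *m gam j + gam j *m gam i =
  (- (realC (eps i) *+ (i == j)) *+ 2)%:M.
Proof. by rewrite sgamP; congr (_%:M); rewrite rmorphMn rmorphN rmorphMn. Qed.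

Definition conn_coef (X : field M) (i j : 'I_n) (q : M) : R :=
  2^-1 * (eps i * eps j * g q (nabla X (s i) q) (s j q)).

Local Notation conn_form X q := (cl_quad gam (fun i j => realC (conn_coef X i j q))).

Lemma conn_coef_smooth X i j : vfield W X -> smooth_on W (conn_coef X i j).
Proof.
move=> vX; apply: smooth_onM => //; first exact: smooth_on_cst.
apply: smooth_onM => //; first exact: smooth_on_cst.
by apply: metric_smooth => //; exact: vN.
Qed.

(** Compatibility is applied to g(s_i, s_j), which is constant on W. *)
Lemma conn_coef_skew X q : W q -> vfield W X ->
  forall i j, conn_coef X i j q = - conn_coef X j i q.
Proof.
move=> Wq vX i j; have tX := t Wq vX.
have := metric_conn_metric mN oW vX (vs i) (vs j) Wq.
have -> : X q (fun r => g r (s i r) (s j r)) = X q (fun=> eps i *+ (i == j)).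
  apply: (tangent_ext oW Wq tX); first exact: metric_smooth.
  by move=> r Wr; exact: (frame_ortho hs).
rewrite (tangent_cst oW Wq tX) [g q (s i q) _]metricC//; [|exact: t|by apply: t => //; exact: vN].
move/esym/eqP; rewrite addr_eq0 /conn_coef => /eqP ->.
by rewrite [eps i * _]mulrC !mulrN.
Qed.

(** The coefficients of X /\ V in the frame are exactly g(nabla_X s_i - D_X s_i, s_j), so the
    torsion term merges into the connection form. In [curvS_local], phi is also a derivative of
    psi. *)
Lemma nablaS_local X (phi : sections T) q : vfield W X -> W q ->
  nablaS D V X phi a q = mxderiv (X q) (phi a) + conn_form X q *m phi a q.
Proof.
move=> vX Wq; rewrite /nablaS /nablaS_LC -addrA; congr (_ + _).
  by apply/matrixP => i j; rewrite !mxE (ord1 j).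
rewrite scalemxAl -mulmxDl; congr (_ *m _).
rewrite /cl2 scaler_sumr -big_split; apply: eq_bigr => i _.
rewrite scaler_sumr -big_split; apply: eq_bigr => j _ /=.
rewrite scalerA -scalerDl; congr (_ *: _).
rewrite -rmorphM -rmorphD /=; congr realC.
rewrite /conn_coef (metric_nablaV hg hD hV oW Wq vX (vs i) (t Wq (vs j))) /wedge11.
ring.
Qed.

Lemma mxsmooth_mxderiv X b c (F : M -> 'M[C]_(b, c)) : vfield W X ->
  mxsmooth_on W F -> mxsmooth_on W (fun q => mxderiv (X q) F).
Proof.
move=> vX sF i j; have [s1 s2] := sF i j; split.
  by under eq_fun do rewrite mxE; exact: vfield_smooth.
by under eq_fun do rewrite mxE; exact: vfield_smooth.
Qed.

Lemma mxderiv_lie X Y b c (F : M -> 'M[C]_(b, c)) q : W q -> mxsmooth_on W F ->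
  mxderiv (lie X Y q) F =
  mxderiv (X q) (fun r => mxderiv (Y r) F) - mxderiv (Y q) (fun r => mxderiv (X r) F).
Proof.
move=> Wq sF; apply/matrixP => i j; rewrite !mxE /=; have [s1 s2] := sF i j.
have E A : (fun r => mxderiv (A r) F i j) = (fun r => cderiv (A r) (fun x => F x i j)).
  by apply/funext => r; rewrite mxE.
by rewrite !E {1}/cderiv (lieE _ _ oW Wq s1) (lieE _ _ oW Wq s2).
Qed.

Variables (p : M) (Wp : W p).
Local Notation K X Y Z A := (g p (curvV g D V X Y Z p) (A p)).

(** Cartan's structure equation in the frame s. The quadratic term is the commutator of the
    connection forms given by [cl_quad_comm]; it matches the products of covariant derivatives in
    [curvature_metric] by [pars]. *)
Lemma conn_coef_curvature X Y i j : vfield W X -> vfield W Y ->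
  X p (conn_coef Y i j) - Y p (conn_coef X i j) - conn_coef (lie X Y) i j p
  + (\sum_k eps k * (conn_coef X k i p * conn_coef Y k j p
                     - conn_coef X k j p * conn_coef Y k i p)) *+ 2
  = 2^-1 * (eps i * eps j * K X Y (s i) (s j)).
Proof.
move=> vX vY.
have coefD A B : vfield W A -> vfield W B -> A p (conn_coef B i j) =
    2^-1 * (eps i * eps j * A p (fun q => g q (nabla B (s i) q) (s j q))).
  move=> vA vB; have sB : smooth_on W (fun q => g q (nabla B (s i) q) (s j q)).
    by apply: metric_smooth => //; exact: vN.
  have tA := t Wp vA.
  rewrite -(tangentZ oW Wp tA _ sB) -(tangentZ oW Wp tA)//.
  by apply: smooth_onM => //; exact: smooth_on_cst.
rewrite (curvature_metric hg mN oW Wp vX vY (vs i) (vs j)) !coefD// [conn_coef (lie X Y) i j p]/conn_coef.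
have pars A B : vfield W A -> vfield W B -> g p (nabla B (s i) p) (nabla A (s j) p) =
    \sum_k eps k * (g p (nabla B (s i) p) (s k p) * g p (nabla A (s j) p) (s k p)).
  move=> vA vB; rewrite -(frame_parseval hg hs Wp (t Wp (vN vB (vs i))) (t Wp (vN vA (vs j)))).
  apply: eq_bigr => k _; congr (_ * (_ * _)); apply: (metricC hg); apply: t => //; exact: vN.
have -> : (\sum_k eps k * (conn_coef X k i p * conn_coef Y k j p
                     - conn_coef X k j p * conn_coef Y k i p)) *+ 2 =
   2^-1 * (eps i * eps j * (g p (nabla X (s i) p) (nabla Y (s j) p)
                            - g p (nabla Y (s i) p) (nabla X (s j) p))).
  rewrite !pars// -sumrB !mulr_sumr -sumrMnl; apply: eq_bigr => k _.
  rewrite !(conn_coef_skew Wp _ k)// /conn_coef.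
  have ek := sign_sqr hs k.
  have two : (2 : R) * 2^-1 = 1 by rewrite divff// pnatr_eq0.
  (* Isolates the factors that simplify: the doubling from the commutator against one of the two
     halves, and [eps k] squared. *)
  transitivity ((2 * 2^-1) * 2^-1 * (eps k * (eps i * eps j) * (eps k * eps k) * (
     g p (nabla X (s i) p) (s k p) * g p (nabla Y (s j) p) (s k p)
     - g p (nabla X (s j) p) (s k p) * g p (nabla Y (s i) p) (s k p)))); first ring.
  rewrite two ek; ring.
ring.
Qed.

(** Locally nabla_Z = Z + A_Z. The second derivatives of psi cancel against the bracket, and X(A_Y)
    - Y(A_X) - A_[X,Y] + [A_X, A_Y] remains. *)
Lemma curvS_local X Y : vfield W X -> vfield W Y ->
  curvS D V X Y psi a p =
  cl_quad gam (fun i j => realC (2^-1 * (eps i * eps j * K X Y (s i) (s j)))) *m psi a p.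
Proof.
move=> vX vY; set F := psi a.
have vL := metric_conn_lie mN oW vX vY.
have sF : mxsmooth_on W F.
  move=> k l; rewrite (ord1 l); case: hpsi => + _ => /(_ a k).
  exact: csmooth_on_sub.
have sA Z vZ := mxsmooth_cl_quad gam oW (fun i j => @conn_coef_smooth Z i j vZ).
have step Z Z' : vfield W Z -> vfield W Z' ->
    nablaS D V Z (nablaS D V Z' psi) a p =
    mxderiv (Z p) (fun q => mxderiv (Z' q) F)
    + (cl_quad gam (fun i j => realC (Z p (conn_coef Z' i j))) *m F p
       + conn_form Z' p *m mxderiv (Z p) F
       + conn_form Z p *m (mxderiv (Z' p) F + conn_form Z' p *m F p)).
  move=> vZ vZ'; rewrite nablaS_local// nablaS_local//; have tZ := t Wp vZ.
  rewrite addrA; congr (_ + _).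
  have s1 := mxsmooth_mxderiv vZ' sF.
  have s2 := mxsmooth_onM oW (sA _ vZ') sF.
  rewrite -(mxderiv_cl_quad gam oW (fun i j => conn_coef_smooth i j vZ') Wp tZ).
  rewrite -(mxderivM oW Wp tZ (sA _ vZ') sF) -(mxderivD oW Wp tZ s1 s2).
  apply/esym/(mxderiv_ext oW Wp tZ); first exact: mxsmooth_onD.
  by move=> q Wq; rewrite nablaS_local.
rewrite /curvS !step// nablaS_local// (mxderiv_lie X Y Wp sF).
have comm := cl_quad_comm gam_clifford
  (a := fun i j => realC (conn_coef X i j p)) (b := fun i j => realC (conn_coef Y i j p)).
have sk Z : vfield W Z -> skew_form (fun i j => realC (conn_coef Z i j p)).
  by move=> vZ i j; rewrite (conn_coef_skew Wp vZ) rmorphN.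
have E i j : realC (2^-1 * (eps i * eps j * K X Y (s i) (s j))) =
    realC (X p (conn_coef Y i j)) - realC (Y p (conn_coef X i j))
    - realC (conn_coef (lie X Y) i j p)
    + (\sum_k realC (eps k) *
        (realC (conn_coef X k i p) * realC (conn_coef Y k j p)
         - realC (conn_coef X k j p) * realC (conn_coef Y k i p))) *+ 2.
  rewrite -conn_coef_curvature// rmorphD !rmorphB rmorphMn rmorph_sum /=.
  by congr (_ + _ *+ 2); apply: eq_bigr => k _; rewrite rmorphM rmorphB !rmorphM.
rewrite (eq_cl_quad gam E) cl_quadD !cl_quadB -(comm (sk _ vX) (sk _ vY)).
rewrite !mulmxDr !mulmxDl !mulNmx !mulmxA.
(* b1 and c1 are the mixed terms A_Y X(psi) and A_X Y(psi), which occur in both orders of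
   differentiation. *)
have cancel (d1 a1 b1 c1 e1 d2 a2 e2 l : 'cV[C]_(spin_dim n)) :
    d1 + (a1 + b1 + (c1 + e1)) - (d2 + (a2 + c1 + (b1 + e2))) - (d1 - d2 + l) =
    a1 - a2 - l + (e1 - e2).
  by apply/matrixP => i j; rewrite !mxE; ring.
exact: cancel.
Qed.

End SpinConnection.

(* Two signs differ from the formula as printed, which is false under the
   conventions it is stated with:
   - the frame sum is contracted with eps k (as in the definition of Ric^V; no
     change for a Riemannian metric).  Without eps k it depends on the frame,
     and fails already for V = 0 on a Lorentzian surface of curvature <> 0;
   - the last term is + (dV /\ X) . psi, not - (dV /\ X) . psi.  On Euclidean
     R^3 with V = x_1 d_2 and X = d_3, at the origin: Ric^V(X) = 0, the only
     nonzero R^V(X, e_k) psi is R^V(X, e_1) psi = - 1/2 e_3 . e_2 . psi, so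
     - 2 sum_k e_k . R^V(X, e_k) psi = - e_1 . e_2 . e_3 . psi, while
     dV /\ X = e_1 /\ e_2 /\ e_3. *)
Theorem theorem4p1 (R : realType) (n : nat) (M : manifold R n)
  (g : metric_tensor M) (hg : semi_riemannian g)
  (T : spin_structure g)
  (D : field M -> field M -> field M) (hD : levi_civita g D)
  (V : field M) (hV : vfield setT V)
  (psi : sections T) (hpsi : spinor_field psi)
  (X : field M) (hX : vfield setT X)
  (U : set M) (hU : open U)
  (eps : 'I_n -> R) (e : 'I_n -> field M)
  (he : orthonormal_frame g eps U e)
  (RicX : field M) (hRic : is_ric_vector g D V eps e U X RicX)
  (a : six T) (p : M) (hUp : U p) (hap : sdom a p) :
  clv a p (RicX p) *m psi a p =
    - 2%:C%C *: (\sum_k (eps k)%:C%C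
                    *: (clv a p (e k p) *m curvS D V X (e k) psi a p))
    + cl3 a p (wedge21 g (dflat g D V) X) *m psi a p.
Proof.
pose W := U `&` sdom a.
have oW : open W by apply: openI => //; exact: sdom_open.
have Wp : W p by [].
have Wa : W `<=` sdom a by move=> q [].
have WU : W `<=` U by move=> q [].
have vX : vfield W X by exact: vfield_sub hX.
set s := sframe a; set ep := seps T.
have hs : orthonormal_frame g ep W s by exact: frame_restrict Wa (sframeP a).
have {}he : orthonormal_frame g eps W e by exact: frame_restrict WU he.
have vs i : vfield W (s i) := frame_vfield hs i.
have ve i : vfield W (e i) := frame_vfield he i.
have ts i : tangent p (s i p) := frame_tangent hs i Wp.
have te i : tangent p (e i p) := frame_tangent he i Wp.
(* The coefficients of e_k in the frame s. *)
pose c k j := ep j * g p (e k p) (s j p).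
have gram j m : \sum_k eps k * (c k j * c k m) = ep j *+ (j == m).
  transitivity (ep j * ep m * g p (s j p) (s m p)).
    rewrite -(frame_parseval hg he Wp (ts j) (ts m)) mulr_sumr.
    by apply: eq_bigr => k _; rewrite /c; ring.
  rewrite (frame_ortho hs) //; case: eqVneq => [->|_]; last by rewrite !mulr0n mulr0.
  by rewrite !mulr1n -mulrA (sign_sqr hs) mulr1.
pose K Y Z A := g p (curvV g D V X Y Z p) (A p).
pose t k i j := 2^-1 * (ep i * ep j * K (s k) (s i) (s j)).
have ricE l : g p (RicX p) (s l p) = \sum_k ep k * K (s k) (s k) (s l).
  rewrite (hRic.2 W (s l) oW WU (vs l) p Wp) /ricV.
  rewrite -(frame_contract (L := R^o) (fun k m => K (s k) (s m) (s l)) gram).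
  apply: eq_bigr => i _; congr (_ * _).
  rewrite (curvatureV_frame_sum2 hg hD hV oW Wp hs vX (ve i) (ve i) (vs l)).
  apply: eq_bigr => j _.
  rewrite (curvatureV_frame_sum3 hg hD hV oW Wp hs vX (vs j) (ve i) (vs l)).
  by rewrite mulr_sumr; apply: eq_bigr => m _; rewrite mulrA.
have curvE k : clv a p (e k p) *m curvS D V X (e k) psi a p =
    \sum_j \sum_m ((c k j)%:C%C * (c k m)%:C%C) *:
      (sgam T j *m (cl_quad (sgam T) (fun i l => (t m i l)%:C%C) *m psi a p)).
  rewrite (curvS_local hg hD hV hpsi oW Wa Wp vX (ve k)) /clv /clif mulmx_suml.
  apply: eq_bigr => j _; rewrite mxE.
  have -> : cl_quad (sgam T) (fun i l => (2^-1 * (ep i * ep l *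
        g p (curvV g D V X (e k) (s i) p) (s l p)))%:C%C) =
      \sum_m (c k m)%:C%C *: cl_quad (sgam T) (fun i l => (t m i l)%:C%C).
    rewrite -cl_quad_sum; apply: eq_cl_quad => i l.
    rewrite (curvatureV_frame_sum2 hg hD hV oW Wp hs vX (ve k) (vs i) (vs l)).
    rewrite !mulr_sumr rmorph_sum; apply: eq_bigr => m _ /=.
    by rewrite -rmorphM /t /c /K; congr (_%:C%C); ring.
  rewrite mulmx_suml mulmx_sumr; apply: eq_bigr => m _.
  by rewrite -scalemxAl -scalemxAl -scalemxAr scalerA.
(* [t'] absorbs the sign of the contraction over s, giving the shape that [cl_quad_contract]
   expects. *)
pose t' k i j := (ep k * t k i j)%:C%C.
have skt k : skew_form (t' k).
  move=> i j; rewrite /t' /t /K (curvatureV_skew hg hD hV oW Wp vX (vs k) (vs i) (vs j)).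
  by rewrite -rmorphN; congr (_%:C%C); ring.
have sumE : \sum_k (eps k)%:C%C *: (clv a p (e k p) *m curvS D V X (e k) psi a p) =
    (\sum_k sgam T k *m cl_quad (sgam T) (t' k)) *m psi a p.
  under eq_bigr do rewrite curvE.
  rewrite (frame_contract (d' := fun j => (ep j)%:C%C)); last first.
    move=> j m; rewrite -rmorphMn -gram rmorph_sum; apply: eq_bigr => k _.
    by rewrite !rmorphM.
  rewrite mulmx_suml; apply: eq_bigr => k _.
  have -> : cl_quad (sgam T) (t' k) =
      (ep k)%:C%C *: cl_quad (sgam T) (fun i l => (t k i l)%:C%C).
    by rewrite -cl_quadZ; apply: eq_cl_quad => i j; rewrite -rmorphM.
  by rewrite -scalemxAr -scalemxAl mulmxA.
have half_eq (x : R) : 2%:C%C * (2^-1 * x)%:C%C = x%:C%C.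
  rewrite -[LHS](rmorphM (real_complex R)) mulrA divff ?mul1r// pnatr_eq0.
have RicE : clv a p (RicX p) = 2%:C%C *: \sum_k \sum_j ((ep k)%:C%C * t' k k j) *: sgam T j.
  rewrite exchange_big scaler_sumr; apply: eq_bigr => l _.
  rewrite mxE ricE -scaler_suml scalerA; congr (_ *: _).
  rewrite !mulr_sumr rmorph_sum; apply: eq_bigr => k _.
  apply: etrans (esym (half_eq _)) _; congr (_ * _).
  rewrite -rmorphM; congr (_%:C%C); rewrite /t.
  have ek := sign_sqr hs k.
  (* Three signs [ep k] meet here: from the contraction, from the curvature coefficient, and from
     the square of [sgam T k]. Two of them cancel. *)
  transitivity (2^-1 * (ep l * ((ep k * ep k) * ep k * K (s k) (s k) (s l)))); last ring.
  by rewrite ek mul1r.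
have cl3E : cl3 a p (wedge21 g (dflat g D V) X) =
    2%:C%C *: cl_cubic (sgam T) (fun i j k => t' i j k + t' j k i + t' k i j).
  rewrite scaler_sumr; apply: eq_bigr => i _; rewrite scaler_sumr.
  apply: eq_bigr => j _; rewrite scaler_sumr; apply: eq_bigr => k _.
  rewrite scalerA; congr (_ *: _).
  apply: etrans (esym (half_eq _)) _; congr (_ * _); rewrite -!rmorphD; congr (_%:C%C).
  (* All three cyclic terms carry the same sign product [ep i * ep j * ep k]. *)
  rewrite -(curvatureV_cyclic hg hD hV oW Wp vX (vs i) (vs j) (vs k)) /t /K -/s -/ep; ring.
(* With A the trace and B the cubic part, the contraction is - A + B, Ric acts as 2 A and the 3-form
   as 2 B, so the claim reads 2 A = - 2 (- A + B) + 2 B. *)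
rewrite sumE (cl_quad_contract (gam_clifford T) skt).
rewrite scalemxAl -mulmxDl scalerDr scalerN cl3E RicE scaleNr opprK scaleNr.
by rewrite subrK.
Qed.
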